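(* Let $\mathcal{I} = \{I_k\}_{k \in \mathbb{N}}$ be a graded family of monomial ideals in $R = \Bbbk[x_1,\dots,x_n]$ and let $\overline{\mathcal{I}} = \{\overline{I_k}\}_{k \in \mathbb{N}}$. The following are equivalent: \begin{enumerate} \item $\mathcal{I}$ satisfies any of the following (mutually equivalent) conditions: (a) the limiting body $\mathcal{C}(\mathcal{I}) = \bigcup_{k \in \mathbb{N}} \frac{1}{k}\mathrm{NP}(I_k)$ is a polyhedron; (b) there exists an integer $c \in \mathbb{N}$ such that $\Delta(\mathcal{I}) = \frac{1}{c}\mathrm{NP}(I_c)$; (c) there exists an integer $c \in \mathbb{N}$ such that $\frac{1}{c}\mathrm{NP}(I_c) = \frac{1}{kc}\mathrm{NP}(I_{kc})$ for all $k \in \mathbb{N}$. \item There exists an integer $c \in \mathbb{N}$ such that $\overline{I_c^k} = \overline{I_{kc}}$ for all $k \in \mathbb{N}$. \item The Rees algebra $\mathcal{R}(\overline{\mathcal{I}})$ is Noetherian. \item The Rees algebra $\mathcal{R}(\mathcal{I})$ is Noetherian. \end{enumerate}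
   Context: $\Bbbk$ is a field, $R = \Bbbk[x_1,\dots,x_n]$, and $\mathbb{N}$ denotes the positive integers. For $\mathbf{a} = (a_1,\dots,a_n) \in \mathbb{Z}^n_{\ge 0}$, $x^{\mathbf a} = x_1^{a_1}\cdots x_n^{a_n}$. $\overline{J}$ denotes the integral closure of an ideal $J$. A collection $\mathcal{I} = \{I_k\}_{k\in\mathbb{N}}$ of ideals of $R$ is a graded family if $I_p I_q \subseteq I_{p+q}$ for all $p,q$; one sets $I_0 = R$. If $\mathcal{I}$ is a graded family of monomial ideals then so is $\overline{\mathcal{I}}$ (with degree-$0$ term $R$). The Rees algebra of $\mathcal{I}$ is $\mathcal{R}(\mathcal{I}) = \bigoplus_{k\ge 0} I_k t^k \subseteq R[t]$. The Newton polyhedron of a monomial ideal $I$ is $\mathrm{NP}(I)$, the convex hull in $\mathbb{R}^n$ of $\{\mathbf{a} \in \mathbb{Z}^n_{\ge 0} : x^{\mathbf{a}} \in I\}$ (so $\mathrm{NP}(0)=\emptyset$). The Newton-Okounkov body of $\mathcal{I}$ is $\Delta(\mathcal{I}) = \overline{\bigcup_{k\in\mathbb{N}} \{\mathbf{a}/k : x^{\mathbf{a}} \in I_k\}} \subseteq \mathbb{R}^n$ (topological closure). A polyhedron in $\mathbb{R}^n$ is an intersection of finitely many closed half-spaces. *)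

(* Defs.v *)
(* mpoly has to be imported before the topology files: their notations clash
   when loaded in the other order. *)
From mathcomp Require Import all_boot all_order all_algebra.
From mathcomp Require Import mpoly.
From mathcomp Require Import boolp classical_sets reals topology normedtype.
From mathcomp Require Import convex.
Import numFieldNormedType.Exports.

Set Implicit Arguments.
Unset Strict Implicit.
Unset Printing Implicit Defensive.

Import Order.TTheory GRing.Theory Num.Theory.

Local Open Scope classical_set_scope.
Local Open Scope ring_scope.

Section Ideals.
Variable A : comNzRingType.
Implicit Types (S G I J : set A).

(* [J] is an ideal of the subring [S] of [A]; the ideals of [A] itself are the
   case [S = setT].  MathComp's [idealr_closed] is not used because it only
   covers proper ideals. *)
Definition ideal_of S J : Prop :=
  [/\ J `<=` S,
      J 0,
      forall x y, J x -> J y -> J (x + y) &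
      forall a x, S a -> J x -> J (a * x)].

Definition ideal_gen S G : set A := smallest (ideal_of S) G.

Definition noetherian_subring S : Prop :=
  forall J, ideal_of S J -> exists s : seq A, J = ideal_gen S [set x | x \in s].

Definition ideal_mul I J : set A :=
  ideal_gen setT [set x * y | x in I & y in J].

Definition ideal_pow J (k : nat) : set A := iter k (ideal_mul J) setT.

Definition integral_closure J : set A :=
  [set r | exists d : nat, exists a : nat -> A,
    [/\ (0 < d)%N,
        forall i, (0 < i <= d)%N -> ideal_pow J i (a i) &
        r ^+ d + \sum_(1 <= i < d.+1) a i * r ^+ (d - i) = 0]].

(* A family indexed by the positive integers is encoded on [nat], with the
   convention that its term of index 0 is the whole ring. *)
Definition graded_family (F : nat -> set A) : Prop :=
  [/\ F 0%N = setT,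
      forall k, ideal_of setT (F k) &
      forall p q, ideal_mul (F p) (F q) `<=` F (p + q)%N].

Definition rees_algebra (F : nat -> set A) : set {poly A} :=
  [set p | forall k, F k p`_k].

End Ideals.

Section Monomial.
Variables (K : fieldType) (n : nat).

Definition monomial_ideal (J : set {mpoly K[n]}) : Prop :=
  exists M : set 'X_{1..n}, J = ideal_gen setT [set 'X_[m] | m in M].

Definition exponents (J : set {mpoly K[n]}) : set 'X_{1..n} :=
  [set m | J 'X_[m]].

End Monomial.

Section Convex.
Variables (R : realType) (n : nat).

Definition halfspace (H : set 'rV[R]_n) : Prop :=
  exists a : 'rV[R]_n, exists b : R,
    a != 0 /\ H = [set x | \sum_i a 0 i * x 0 i <= b].

Definition polyhedron (P : set 'rV[R]_n) : Prop :=
  exists m : nat, exists H : 'I_m -> set 'rV[R]_n,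
    (forall i, halfspace (H i)) /\ P = \bigcap_i H i.

Definition convex_hull (G : set 'rV[R]_n) : set 'rV[R]_n :=
  smallest (@convex_set R 'rV[R]_n) G.

Definition dilate (c : R) (P : set 'rV[R]_n) : set 'rV[R]_n :=
  [set c *: x | x in P].

Definition mnm_vec (m : 'X_{1..n}) : 'rV[R]_n := \row_i (m i)%:R.

Variable K : fieldType.
Implicit Type F : nat -> set {mpoly K[n]}.

Definition newton_polyhedron (J : set {mpoly K[n]}) : set 'rV[R]_n :=
  convex_hull [set mnm_vec m | m in exponents J].

Definition limiting_body F : set 'rV[R]_n :=
  \bigcup_(k in [set k | (0 < k)%N]) dilate k%:R^-1 (newton_polyhedron (F k)).

Definition newton_okounkov_body F : set 'rV[R]_n :=
  closure (\bigcup_(k in [set k | (0 < k)%N])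
             [set k%:R^-1 *: mnm_vec m | m in exponents (F k)]).

End Convex.

Arguments newton_polyhedron R {n K} J.
Arguments limiting_body R {n K} F.
Arguments newton_okounkov_body R {n K} F.

(* Main.v *)
(* Everything reduces to the exponent sets [E k] of [I k], which are upward
   closed subsets of N^n.

   The integral closure of a monomial ideal is spanned by the monomials [x^m]
   such that some [q m], [q > 0], is a sum of [q] exponents of the ideal, and
   these [m] are the lattice points of the Newton polyhedron.  Both facts come
   from the same remark: by Dickson's lemma it is enough that [N m] is a sum of
   [N - d] exponents for all [N] and a fixed [d].

   The pivot of the equivalences is the condition on [c] that [c a] lies, up to
   a common multiple, in [k] times the hull of [E c] for all [a] in [E k].  It
   makes the limiting body equal to [1/c NP(I_c)], which is a polyhedron by
   Fourier-Motzkin elimination.  It makes both Rees algebras Noetherian, since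
   their monomials are covered by finitely many translates of the semigroup
   generated by the variables and by finitely many [x^g t^c] with [g] in [E c];
   Dickson's lemma and division with remainder by leading monomials then give
   finite generation of ideals.  Conversely, finite generation of the ideal of
   positive [t]-degree of either algebra gives the condition for [c = N!],
   where [N] bounds the degrees of the generators. *)

Require Import Defs.
From HB Require Import structures.
From mathcomp Require Import all_boot all_order all_algebra.
From mathcomp Require Import mpoly zify ring lra.
From mathcomp Require Import boolp classical_sets reals topology normedtype.
From mathcomp Require Import convex interval_inference.
Import numFieldNormedType.Exports.

Set Implicit Arguments.
Unset Strict Implicit.
Unset Printing Implicit Defensive.

Import Order.TTheory GRing.Theory Num.Theory.

Local Open Scope classical_set_scope.
Local Open Scope ring_scope.

(** * Dickson's lemma for families of numerical functions *)

Section Dickson.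
Local Open Scope nat_scope.

(** Values are lists so that [[::]] can serve outside [l], even when [X] is empty; a single witness
    is passed as a singleton. *)
Lemma seq_choice (I X : eqType) (l : seq I) (Q : I -> seq X -> Prop) :
  (forall i, i \in l -> exists s, Q i s) ->
  exists s : I -> seq X, forall i, i \in l -> Q i (s i).
Proof.
move=> H.
have /choice [s sP] : forall i, exists s, i \in l -> Q i s.
  by move=> i; case: (boolP (i \in l)) => [/H[s]|_]; [exists s|exists [::]].
by exists s.
Qed.

(* Either a point dominates a fixed [x0] of [A], or one of its coordinates is
   among finitely many values, and that coordinate can then be dropped. *)
Lemma dickson_seq (X I : eqType) (F : I -> X -> nat) (l : seq I) (A : set X) :
  exists2 s : seq X, (forall x, x \in s -> A x) &
    forall x, A x -> exists2 u, u \in s & forall i, i \in l -> F i u <= F i x.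
Proof.
move: {2}(size l) (erefl (size l)) => d; elim: d => [|d IH] in l A *.
  move=> /size0nil ->.
  have [[x0 Ax0]|nA] := pselect (exists x, A x); last first.
    by exists [::] => // x Ax; case: nA; exists x.
  by exists [:: x0] => [x|x _]; [rewrite inE => /eqP ->|exists x0; rewrite ?inE].
move=> sl.
have [[x0 Ax0]|nA] := pselect (exists x, A x); last first.
  by exists [::] => // x Ax; case: nA; exists x.
pose J := [seq (i, v) | i <- l, v <- iota 0 (F i x0)].
pose Q (iv : I * nat) (s : seq X) :=
  (forall x, x \in s -> A x) /\
  forall x, A x -> F iv.1 x = iv.2 -> exists2 u, u \in s &
    forall i, i \in l -> F i u <= F i x.
have [iv ivJ|s sP] := @seq_choice _ X J Q.
  have /allpairsPdep [i [v [il _ ->]]] := ivJ.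
  have [|s sA sP] := IH (rem i l) [set x | A x /\ F i x = v].
    by rewrite size_rem // sl.
  exists s; split=> [x /sA []//|x Ax /= Fx].
  have [u us uP] := sP x (conj Ax Fx); exists u => // j jl.
  have [_ Fu] := sA u us.
  have [-> |ne] := eqVneq j i; first by rewrite Fu Fx.
  by apply: uP; move: jl; rewrite (perm_mem (perm_to_rem il)) inE (negPf ne).
exists (x0 :: flatten [seq s iv | iv <- J]).
  move=> x; rewrite inE => /orP[/eqP -> //|/flatten_mapP [iv ivJ xs]].
  by have [sA _] := sP _ ivJ; exact: sA.
move=> x Ax; have [ge0|] := boolP (all (fun i => F i x0 <= F i x) l).
  by exists x0; [rewrite mem_head|move=> i /(allP ge0)].
case/allPn => i il; rewrite -ltnNge => lt.
have ivJ : (i, F i x) \in J.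
  by apply/allpairsPdep; exists i, (F i x); rewrite mem_iota.
have [_ /(_ x Ax erefl) [u us uP]] := sP _ ivJ.
by exists u => //; rewrite inE; apply/orP; right; apply/flatten_mapP;
  exists (i, F i x).
Qed.

Lemma dickson (X : eqType) (I : finType) (F : I -> X -> nat) (A : set X) :
  exists2 s : seq X, (forall x, x \in s -> A x) &
    forall x, A x -> exists2 u, u \in s & forall i, F i u <= F i x.
Proof.
have [s sA sP] := dickson_seq F (enum I) A; exists s => // x /sP [u us uP].
by exists u => // i; apply: uP; rewrite mem_enum.
Qed.

(** A finite basis of the set of all indices is compared with an index larger than every member of
    the basis. *)
Lemma dickson_pair (I : finType) (F : nat -> I -> nat) :
  exists i j, i < j /\ forall t, F i t <= F j t.
Proof.
have [s _ sP] := dickson (fun t N => F N t) [set: nat].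
have [u us uP] := sP (\max_(x <- s) x).+1 Logic.I.
exists u, (\max_(x <- s) x).+1; split => //.
by rewrite ltnS; exact: (@leq_bigmax_seq _ _ xpredT (fun x => x)).
Qed.

End Dickson.

(** * Sums of exponents and saturation of upward closed sets *)

Section Sumsets.
Variable n : nat.
Implicit Types (E F G : set 'X_{1..n}) (m a b : 'X_{1..n}).

Definition upset E := forall a b, E a -> E (a + b)%MM.

(** This mirrors the powers of an ideal: the power 0 is the whole ring, so the case 0 is [setT] and
    not the singleton of the zero exponent. *)
Fixpoint sumset E k : set 'X_{1..n} :=
  if k is k'.+1 then [set (a + b)%MM | a in E & b in sumset E k'] else setT.

Definition saturation E : set 'X_{1..n} :=
  [set m | exists2 q, (0 < q)%N & sumset E q (m *+ q)%MM].

Lemma upset_le E a b : upset E -> E a -> (a <= b)%MM -> E b.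
Proof. by move=> uE Ea /submK <-; rewrite addmC; exact: uE. Qed.

Lemma mulmDl m p q : (m *+ (p + q) = m *+ p + m *+ q)%MM.
Proof. by apply/mnmP => i; rewrite !(mnmDE, mulmnE); lia. Qed.

Lemma mulmDr a b q : ((a + b) *+ q = a *+ q + b *+ q)%MM.
Proof. by apply/mnmP => i; rewrite !(mnmDE, mulmnE); lia. Qed.

Lemma mulmM m p q : (m *+ (p * q) = (m *+ p) *+ q)%MM.
Proof. by apply/mnmP => i; rewrite !mulmnE; lia. Qed.

Lemma sumset1 E m : upset E -> sumset E 1 m <-> E m.
Proof.
move=> uE; split=> [[a Ea [b _ <-]]|Em]; first exact: uE.
by exists m => //; exists 0%MM => //; rewrite addm0.
Qed.

Lemma sumset_up E k : upset E -> upset (sumset E k).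
Proof.
move=> uE; elim: k => [//|k IH] c b [x Ex [y yE <-]].
by exists x => //; rewrite -addmA; exists (y + b)%MM => //; exact: IH.
Qed.

Lemma sumsetD E p q a b : upset E ->
  sumset E p a -> sumset E q b -> sumset E (p + q) (a + b)%MM.
Proof.
move=> uE; elim: p a => [|p IH] a.
  by move=> _ qb; rewrite add0n addmC; exact: sumset_up.
move=> [x Ex [y yp <-]] qb; rewrite addSn -addmA.
by exists x => //; exists (y + b)%MM => //; exact: IH.
Qed.

Lemma sumset_split E p q a : sumset E (p + q) a ->
  exists b c, [/\ sumset E p b, sumset E q c & a = (b + c)%MM].
Proof.
elim: p a => [|p IH] a; first by exists 0%MM, a; rewrite add0m.
move=> [x Ex [y /IH [b [c [pb qc ->]]] <-]].
by exists (x + b)%MM, c; split=> //; [exists x => //; exists b|rewrite addmA].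
Qed.

Lemma sumset_le E p q a : upset E -> (p <= q)%N -> sumset E q a -> sumset E p a.
Proof.
move=> uE /subnKC <- /sumset_split [b [c [pb _ ->]]]; exact: sumset_up.
Qed.

Lemma sumset_mono E F k : E `<=` F -> sumset E k `<=` sumset F k.
Proof.
move=> EF; elim: k => [//|k IH] _ [a Ea [b kb <-]].
by exists a; [exact: EF|exists b => //; exact: IH].
Qed.

Lemma sumset_mul E p q : upset E -> sumset (sumset E p) q `<=` sumset E (q * p).
Proof.
move=> uE; elim: q => [//|q IH] _ [a pa [b /IH qb <-]].
by rewrite mulSn; exact: sumsetD.
Qed.

Lemma sumset_div E p q : sumset E (q * p) `<=` sumset (sumset E p) q.
Proof.
elim: q => [//|q IH] x; rewrite mulSn => /sumset_split [b [c [pb /IH qc ->]]].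
by exists b => //; exists c.
Qed.

Lemma sumset_scale E q k m : upset E ->
  sumset E q m -> sumset E (q * k) (m *+ k)%MM.
Proof.
move=> uE qm; elim: k => [|k IH]; first by rewrite muln0.
by rewrite mulnS mulmS; exact: sumsetD.
Qed.

Lemma sub_saturation E : upset E -> E `<=` saturation E.
Proof. by move=> uE m Em; exists 1%N => //; rewrite mulm1n; apply/sumset1. Qed.

Lemma saturation_up E : upset E -> upset (saturation E).
Proof.
by move=> uE a b [q q0 qa]; exists q => //; rewrite mulmDr; exact: sumset_up.
Qed.

Lemma saturation_mono E F : E `<=` F -> saturation E `<=` saturation F.
Proof. by move=> EF m [q q0 qm]; exists q => //; exact: sumset_mono EF _ qm. Qed.

Lemma upset_generators E : upset E -> exists r (g : 'I_r -> 'X_{1..n}),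
  (forall i, E (g i)) /\ forall m, E m -> exists i, (g i <= m)%MM.
Proof.
move=> uE; have [s sE sP] := dickson (fun (i : 'I_n) m => m i) E.
exists (size s), (tnth (in_tuple s)); split=> [i|m /sP [u us uP]].
  by apply: sE; exact: mem_tnth.
have /tnthP [i ui] : u \in in_tuple s by [].
by exists i; rewrite -ui; apply/mnm_lepP.
Qed.

(** Membership becomes a system of inequalities between natural numbers, where [e i] counts the uses
    of [g i] and upward closure absorbs the slack. *)
Lemma sumset_generators E r (g : 'I_r -> 'X_{1..n}) k m : upset E ->
    (forall i, E (g i)) -> (forall m, E m -> exists i, (g i <= m)%MM) ->
  sumset E k m <-> exists2 e : 'I_r -> nat, (\sum_i e i = k)%N &
     forall j, (\sum_i e i * g i j <= m j)%N.
Proof.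
move=> uE gE Eg; split.
  elim: k m => [|k IH] m.
    by exists (fun=> 0%N) => [|j]; rewrite big1.
  move=> [a /Eg [i0 /mnm_lepP ga] [b /IH [e ek eb] <-]].
  exists (fun i => e i + (i == i0))%N => [|j].
    rewrite big_split /= ek (bigD1 i0) //= eqxx big1 ?addn1 //.
    by move=> i /negPf ->.
  rewrite mnmDE; under eq_bigr do rewrite mulnDl; rewrite big_split /=.
  rewrite addnC leq_add // (bigD1 i0) //= eqxx mul1n big1 ?addn0 //.
  by move=> i /negPf ->.
move=> [e ek em].
suff H : sumset E k (\sum_i g i *+ e i)%MM.
  apply: (upset_le (sumset_up uE) H); apply/mnm_lepP => j.
  by rewrite mnm_sumE; under eq_bigr do rewrite mulmnE mulnC.
rewrite -ek; elim/big_rec2: _ => [//|i k' m' _ H].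
apply: sumsetD => //.
by rewrite -[X in sumset _ X]mul1n; apply: sumset_scale => //; exact/sumset1.
Qed.

(** Dickson's lemma provides [N < N'] with comparable representations. Subtracting them puts
    [m *+ (N' - N)] into the sumset of index [N' - N]: the fixed loss [d] cancels. *)
Lemma asymptotic_saturation E m d : upset E ->
  (forall N, sumset E (N - d) (m *+ N)%MM) -> saturation E m.
Proof.
move=> uE H; have [r [g [gE Eg]]] := upset_generators uE.
have /choice [e eP] : forall N, exists e : 'I_r -> nat, (\sum_i e i = N)%N /\
    forall j, (\sum_i e i * g i j <= m j * (N + d))%N.
  move=> N; have /(sumset_generators _ _ uE gE Eg) [e eN em] := H (N + d)%N.
  by exists e; split=> [|j]; [rewrite eN addnK|rewrite -mulmnE].
(* The slacks of the inequalities are compared along with the multiplicities, so that the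
   inequalities survive the subtraction. *)
pose F N (t : 'I_r + 'I_n) := match t with
  | inl i => e N i | inr j => (m j * (N + d) - \sum_i e N i * g i j)%N end.
have [N [N' [lt le]]] := dickson_pair F.
have [eN em] := eP N; have [eN' em'] := eP N'.
exists (N' - N)%N; first by rewrite subn_gt0.
apply/(sumset_generators _ _ uE gE Eg); exists (fun i => e N' i - e N i)%N.
  by rewrite sumnB ?eN ?eN' // => i _; exact: (le (inl i)).
move=> j; have := le (inr j); have := em j; have := em' j; rewrite /F mulmnE.
under [X in _ -> _ -> _ -> (X <= _)%N]eq_bigr do rewrite mulnBl.
rewrite sumnB => [|i _]; last by rewrite leq_mul2r (le (inl i)) orbT.
have -> : (m j * (N' - N) = m j * (N' + d) - m j * (N + d))%N by rewrite -mulnBr;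
  congr muln; lia.
by have : (m j * (N + d) <= m j * (N' + d))%N; [apply: leq_mul; lia|lia].
Qed.

End Sumsets.

(** * Ideals of subrings, powers of ideals and Rees algebras *)

Section IdealPowers.
Variable A : comNzRingType.
Implicit Types (S G I J : set A) (F : nat -> set A).

Lemma ideal_gen_ideal S G : S 0 ->
    (forall x y, S x -> S y -> S (x + y)) ->
    (forall x y, S x -> S y -> S (x * y)) -> G `<=` S ->
  ideal_of S (ideal_gen S G).
Proof.
move=> S0 SD SM GS; split.
- by apply: smallest_sub => //; split.
- by move=> J [[]].
- by move=> x y xG yG J JG; have [[_ _ JD _] _] := JG; apply: JD;
  [exact: xG|exact: yG].
- by move=> a x Sa xG J JG; have [[_ _ _ JM] _] := JG; apply: JM => //; exact: xG.
Qed.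

Lemma ideal_of_setT : ideal_of setT (setT : set A).
Proof. by split. Qed.

Lemma ideal_of_sum S J (T : Type) (r : seq T) (P : pred T) (f : T -> A) :
  ideal_of S J -> (forall i, P i -> J (f i)) -> J (\sum_(i <- r | P i) f i).
Proof. by move=> [_ J0 JD _] fJ; elim/big_ind: _. Qed.

Lemma ideal_of_sum_seq S J (T : eqType) (r : seq T) (f : T -> A) :
  ideal_of S J -> (forall i, i \in r -> J (f i)) -> J (\sum_(i <- r) f i).
Proof. by move=> Ji fJ; rewrite big_seq; exact: ideal_of_sum Ji fJ. Qed.

Lemma ideal_of_opp J x : ideal_of setT J -> J x -> J (- x).
Proof. by move=> [_ _ _ JM] Jx; rewrite -mulN1r; exact: JM. Qed.

Lemma ideal_mul_ideal I J : ideal_of setT (ideal_mul I J).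
Proof. exact: ideal_gen_ideal. Qed.

Lemma mul_ideal_mul I J x y : I x -> J y -> ideal_mul I J (x * y).
Proof. by move=> Ix Jy; apply: sub_gen_smallest; exists x => //; exists y. Qed.

Lemma ideal_pow_ideal J k : ideal_of setT (ideal_pow J k).
Proof. by case: k => [|k]; [exact: ideal_of_setT|exact: ideal_mul_ideal]. Qed.

Lemma ideal_powD J p q x y :
  ideal_pow J p x -> ideal_pow J q y -> ideal_pow J (p + q) (x * y).
Proof.
elim: p x => [|p IH] x.
  by move=> _ yq; have [_ _ _] := ideal_pow_ideal J q; apply.
move=> xp yq; rewrite addSn.
have [_ J0 JD JM] := ideal_pow_ideal J (p + q).+1.
(* [xp] is membership in a smallest ideal, so it is instantiated at the ideal of all [x] that [y]
   multiplies into the power [(p + q).+1]. *)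
apply: (xp [set x | ideal_pow J (p + q).+1 (x * y)]); split.
  split=> //=; first by rewrite mul0r.
    by move=> u v uy vy; rewrite mulrDl; exact: JD.
  by move=> a u _ uy; rewrite -mulrA; exact: JM.
move=> _ [u Ju [v vp <-]] /=; rewrite -mulrA.
by apply: mul_ideal_mul => //; exact: IH.
Qed.

Lemma ideal_powS J k : ideal_pow J k.+1 `<=` ideal_pow J k.
Proof.
apply: smallest_sub; first exact: ideal_pow_ideal.
by move=> _ [x _ [y yk <-]]; have [_ _ _] := ideal_pow_ideal J k; apply.
Qed.

Lemma ideal_pow_le J p q : (p <= q)%N -> ideal_pow J q `<=` ideal_pow J p.
Proof.
move=> /subnKC <-; elim: (q - p)%N => [|k IH]; first by rewrite addn0.
by move=> x; rewrite addnS => /ideal_powS /IH.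
Qed.

Lemma rees_algebra_subring F : (forall k, ideal_of setT (F k)) ->
    F 0%N = setT ->
    (forall p q x y, F p x -> F q y -> F (p + q)%N (x * y)) ->
  [/\ rees_algebra F 1,
      forall f g, rees_algebra F f -> rees_algebra F g -> rees_algebra F (f - g) &
      forall f g, rees_algebra F f -> rees_algebra F g -> rees_algebra F (f * g)].
Proof.
move=> Fi F0 FM; split.
- by move=> [|k]; rewrite coef1 /= ?F0 //; have [] := Fi k.+1.
- move=> f g Ff Fg k; rewrite coefB; have [_ _ FD _] := Fi k.
  by apply: FD; [exact: Ff|exact: ideal_of_opp].
- move=> f g Ff Fg k; rewrite coefM; apply: (ideal_of_sum _ (Fi k)) => i _.
  have := FM i (k - i)%N _ _ (Ff i) (Fg (k - i)%N).
  by rewrite subnKC // -ltnS.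
Qed.

(** The equation expresses [r ^+ N] through products of [a i] and [r ^+ (N - i)], so by induction
    the loss in the exponent of [J] stays at most [d]. For [N <= d] truncated subtraction leaves the
    whole ring. *)
Lemma integral_pow_sub J d a r :
    (forall i, (0 < i <= d)%N -> ideal_pow J i (a i)) ->
    r ^+ d + \sum_(1 <= i < d.+1) a i * r ^+ (d - i) = 0 ->
  forall N, ideal_pow J (N - d) (r ^+ N).
Proof.
move=> aP rd; elim/ltn_ind => N IH.
have [Nd|/ltnW dN] := leqP N d; first by move: Nd; rewrite -subn_eq0 => /eqP ->.
have -> : r ^+ N = \sum_(1 <= i < d.+1) - (a i * r ^+ (N - i)).
  rewrite -[in LHS](subnKC dN) exprD; move/eqP: rd; rewrite addr_eq0 => /eqP ->.
  rewrite mulNr mulr_suml -sumrN; apply: eq_big_nat => i /andP[_ id].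
  by rewrite -mulrA -exprD; congr (- (_ * r ^+ _)); lia.
apply: (ideal_of_sum_seq (ideal_pow_ideal J (N - d))) => i.
rewrite mem_index_iota => /andP[i0 id].
apply: (ideal_of_opp (ideal_pow_ideal J (N - d))).
apply: (@ideal_pow_le _ _ (i + (N - i - d))); first lia.
by apply: ideal_powD; [apply: aP; lia|apply: IH; lia].
Qed.

End IdealPowers.

(** * The integral closure of an ideal is an ideal *)

Section IntegralClosure.
Variables (A : comNzRingType) (J : set A).

(** The algebra [A[J t]] is turned into a ring type, because [integralOver] speaks of integrality
    along a ring morphism. *)
Definition rees_power_pred : {pred {poly A}} :=
  fun p => `[< rees_algebra (ideal_pow J) p >].

Lemma rees_power_closed : subring_closed rees_power_pred.
Proof.
have [H1 HB HM] := rees_algebra_subring (ideal_pow_ideal J) erefl (@ideal_powD _ J).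
split; first exact/asboolP.
  by move=> f g /asboolP Hf /asboolP Hg; apply/asboolP/HB.
by move=> f g /asboolP Hf /asboolP Hg; apply/asboolP/HM.
Qed.

HB.instance Definition _ :=
  GRing.isSubringClosed.Build {poly A} rees_power_pred rees_power_closed.

Record rees_power := ReesPower {
  rees_power_val : {poly A};
  rees_power_valP : rees_power_val \in rees_power_pred }.

HB.instance Definition _ := [isSub for rees_power_val].
HB.instance Definition _ := [Choice of rees_power by <:].
HB.instance Definition _ := [SubChoice_isSubComNzRing of rees_power by <:].

Let integral (f : {poly A}) := integralOver (val : rees_power -> {poly A}) f.

Lemma rees_over f : rees_algebra (ideal_pow J) f -> integral f.
Proof.
move=> /asboolP Hf; have := @integral_id _ _ (val : {rmorphism rees_power ->
  {poly A}}).
by move=> /(_ (ReesPower Hf)).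
Qed.

(* Integrality over an ideal [J] is integrality of [r t] over the ring [A[J t]],
   for which closure under sums and products is known. *)
Lemma integral_closureE r : integral_closure J r <-> integral (r%:P * 'X).
Proof.
have J0 k : ideal_pow J k 0 by case: (ideal_pow_ideal J k).
split=> [[d [a [d0 aP rd]]]|].
  (* ['X^d + q] is the integral equation of [r] made homogeneous: [a i] receives degree [i] in
     [t]. *)
  pose q : {poly {poly A}} :=
    \sum_(1 <= i < d.+1) ((a i)%:P * 'X^i)%:P * 'X^(d - i).
  have sp : (size q < size ('X^d : {poly {poly A}}))%N.
    rewrite size_polyXn ltnS; apply: (leq_trans (size_sum _ _ _)).
    rewrite big_seq; apply/bigmax_leqP_seq => i _;
      rewrite mem_index_iota => /andP[i0 id].
    rewrite mul_polyC; apply: (leq_trans (size_scale_leq _ _)).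
    by rewrite size_polyXn; lia.
  apply: (@integral_root_monic _ _ _ _ ('X^d + q)).
  - by rewrite monicE lead_coefDl // lead_coefXn.
  - apply/rootP; rewrite hornerD hornerXn horner_sum.
    under eq_bigr do rewrite hornerM hornerC hornerXn.
    have -> : (r%:P * 'X) ^+ d = (r ^+ d)%:P * 'X^d :> {poly A}.
      by rewrite exprMn polyC_exp.
    under eq_big_nat => i /andP[_ id].
      rewrite exprMn -polyC_exp mulrACA -exprD subnKC // -polyCM; over.
    by rewrite -mulr_suml -raddf_sum -mulrDl -polyCD rd mul0r.
  - apply/integral_poly => j; rewrite coefD coef_sum.
    apply: integral_add; first by rewrite coefXn; exact: integral_nat.
    rewrite big_seq; elim/big_ind: _; [exact: integral0|exact: integral_add|].
    move=> i; rewrite mem_index_iota => /andP[i0 id]; rewrite coefCM coefXn.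
    apply: integral_mul; last exact: integral_nat.
    apply: rees_over => k; rewrite coefCM coefXn.
    by case: eqP => [->|_]; rewrite ?mulr1 ?mulr0 //; apply: aP; lia.
move=> [p pm /rootP p0].
have s0 : (0 < size p)%N by rewrite size_poly_gt0 monic_neq0.
pose d := (size p).-1; exists d.
(* Taking the coefficient of degree [d] in [t] of the equation satisfied by [r t] leaves an equation
   for [r] with coefficients in powers of [J]. *)
have pE : \sum_(j < d.+1) (val p`_j)`_(d - j) * r ^+ j = 0.
  have := congr1 (fun q : {poly A} => q`_d) p0; rewrite coef0.
  rewrite horner_coef size_map_poly_id0; last first.
    by rewrite (monicP pm) rmorph1 oner_neq0.
  rewrite -(prednK s0) -/d coef_sum => pd; rewrite -[RHS]pd; apply: eq_bigr => j _.
  rewrite coef_map exprMn -polyC_exp mulrA coefMXn ltnNge -ltnS ltn_ord /=.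
  by rewrite coefMC.
(* For [d = 0] the monic [p] would have constant term 1, and [pE] would read [1 = 0]. *)
have d0 : (0 < d)%N.
  rewrite lt0n; apply/eqP => dE; move: pE; rewrite dE big_ord1 mulr1.
  have : p`_0 = 1 by rewrite -(monicP pm) lead_coefE -/d dE.
  by move=> -> /eqP; rewrite coef1 oner_eq0.
exists (fun i => (val p`_(d - i))`_i); split=> //.
  move=> i _; exact: (asboolW (rees_power_valP p`_(d - i))).
rewrite -[RHS]pE big_ord_recr /= [RHS]addrC; congr (_ + _).
  have : p`_d = 1 by exact: (monicP pm).
  by move=> ->; rewrite subnn coef1 mul1r.
rewrite big_nat_rev /= big_add1 /= big_mkord; apply: eq_bigr => i _.
by rewrite add1n !subSS subKn // ltnW.
Qed.

Lemma integral_closure_ideal : ideal_of setT (integral_closure J).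
Proof.
split=> //.
- by apply/integral_closureE; rewrite mul0r; exact: integral0.
- move=> x y /integral_closureE xJ /integral_closureE yJ.
  by apply/integral_closureE; rewrite polyCD mulrDl; exact: integral_add.
- move=> a x _ /integral_closureE xJ.
  apply/integral_closureE; rewrite polyCM -mulrA; apply: integral_mul => //.
  apply: rees_over => -[|k]; rewrite coefC //=.
  by case: (ideal_pow_ideal J k.+1).
Qed.

End IntegralClosure.

(** * Monomial ideals, their powers and their integral closures *)

Section MonomialIdeals.
Variables (K : fieldType) (n : nat).
Implicit Types (E : set 'X_{1..n}) (J : set {mpoly K[n]}) (f : {mpoly K[n]}).

(** When [E] is upward closed, this is the monomial ideal with exponent set [E]. *)
Definition supported_on E : set {mpoly K[n]} :=
  [set f | forall m, m \in msupp f -> E m].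

Lemma supportedX E m : supported_on E 'X_[m] <-> E m.
Proof.
split=> [|Em m']; first by apply; rewrite msuppX inE.
by rewrite msuppX inE => /eqP ->.
Qed.

Lemma exponents_supported E : exponents (supported_on E) = E.
Proof. by apply/seteqP; split=> m; rewrite /exponents /= supportedX. Qed.

Lemma supportedD E f g :
  supported_on E f -> supported_on E g -> supported_on E (f + g).
Proof. by move=> fE gE m /msuppD_le; rewrite mem_cat => /orP[/fE|/gE]. Qed.

Lemma supported0 E : supported_on E 0.
Proof. by move=> m; rewrite msupp0. Qed.

Lemma supported_sum E (T : Type) (r : seq T) (P : pred T) (F : T -> {mpoly K[n]}) :
  (forall i, P i -> supported_on E (F i)) ->
  supported_on E (\sum_(i <- r | P i) F i).
Proof.
by move=> FE; elim/big_ind: _; [exact: supported0|exact: supportedD|].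
Qed.

Lemma supportedM E1 E2 E f g :
    (forall a b, E1 a -> E2 b -> E (a + b)%MM) ->
  supported_on E1 f -> supported_on E2 g -> supported_on E (f * g).
Proof.
move=> ED fE gE m /msuppM_le /allpairsP [[a b] /= [af bg ->]].
by apply: ED; [exact: fE|exact: gE].
Qed.

Lemma supported_ideal E : upset E -> ideal_of setT (supported_on E).
Proof.
move=> uE; split=> //; [exact: supported0|exact: supportedD|].
move=> f g _; apply: (@supportedM setT) => // a b _ Eb.
by rewrite addmC; exact: uE.
Qed.

Lemma supported_setT : supported_on setT = setT.
Proof. by apply/seteqP; split. Qed.

Lemma ideal_supported_sub J E : ideal_of setT J ->
  (forall m, E m -> J 'X_[m]) -> supported_on E `<=` J.
Proof.
move=> Ji EJ f fE; rewrite [f]mpolyE.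
apply: (ideal_of_sum_seq Ji) => m /fE Em; rewrite -mul_mpolyC.
by case: Ji => _ _ _; apply => //; exact: EJ.
Qed.

Lemma ideal_exponents_up J : ideal_of setT J -> upset (exponents J).
Proof.
move=> [_ _ _ JM] a b Ja; rewrite /exponents /= mpolyXD mulrC; exact: JM.
Qed.

Lemma monomial_idealE J :
  monomial_ideal J -> upset (exponents J) /\ J = supported_on (exponents J).
Proof.
move=> [M ->]; set J' := ideal_gen _ _.
have Ji : ideal_of setT J' by exact: ideal_gen_ideal.
have uJ := ideal_exponents_up Ji.
split => //; apply/seteqP; split; last exact: ideal_supported_sub.
apply: smallest_sub; first exact: supported_ideal.
by move=> _ [m Mm <-]; apply/supportedX; apply: sub_gen_smallest; exists m.
Qed.

Lemma ideal_pow_supported E k : upset E ->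
  ideal_pow (supported_on E) k = supported_on (sumset E k).
Proof.
move=> uE; elim: k => [|k IH]; first by rewrite [RHS]supported_setT.
apply/seteqP; split.
  apply: smallest_sub; first by apply: supported_ideal; exact: sumset_up.
  move=> _ [f fE [g gJ <-]].
  have gE : supported_on (sumset E k) g by rewrite -IH.
  by apply: (supportedM _ fE gE) => a b Ea kb; exists a => //; exists b.
apply: ideal_supported_sub; first exact: ideal_pow_ideal.
move=> _ [a Ea [b kb <-]]; rewrite mpolyXD.
have kb' : ideal_pow (supported_on E) k 'X_[b] by rewrite IH; apply/supportedX.
by apply: mul_ideal_mul => //; apply/supportedX.
Qed.

(** The monomial is a root of [X^q - x^(q m)], whose constant term lies in the [q]-th power of the
    ideal. *)
Lemma saturation_integral E m : upset E ->
  saturation E m -> integral_closure (supported_on E) 'X_[m].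
Proof.
move=> uE [q q0 qm].
exists q, (fun i => if i == q then - 'X_[m *+ q] else 0); split=> //.
  move=> i _; case: eqP => [->|_]; last by case: (ideal_pow_ideal (supported_on E) i).
  apply: ideal_of_opp; first exact: ideal_pow_ideal.
  by rewrite ideal_pow_supported //; exact/supportedX.
rewrite big_nat_recr //= eqxx subnn mulr1 big_nat big1 ?add0r => [|i /andP[_ iq]].
  by rewrite mpolyXn subrr.
by rewrite ltn_eqF // mul0r.
Qed.

(* The leading monomial of [f ^+ N] is the [N]-th power of that of [f], so the
   leading monomial of an integral [f] is integral; subtract it and recurse. *)
Lemma integral_closure_supported E : upset E ->
  integral_closure (supported_on E) = supported_on (saturation E).
Proof.
move=> uE; apply/seteqP; split; last first.
  by apply: ideal_supported_sub; [exact: integral_closure_ideal|move=> m;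
    exact: saturation_integral].
have [_ _ JD JM] := integral_closure_ideal (supported_on E).
elim/mleadrect => f IH fJ; have [->|f0] := eqVneq f 0; first exact: supported0.
have sf : saturation E (mlead f).
  have [d [a [d0 aP rd]]] := fJ; apply: (asymptotic_saturation (d := d)) => // N.
  have := integral_pow_sub aP rd N; rewrite ideal_pow_supported //.
  by apply; rewrite -mleadX // mlead_supp // expf_neq0.
set g := f - f@_(mlead f) *: 'X_[mlead f].
have gE : msupp g =i rem (mlead f) (msupp f) by exact/perm_mem/msupp_rem.
have gJ : integral_closure (supported_on E) g.
  have := JM (- f@_(mlead f))%:MP _ Logic.I (saturation_integral uE sf).
  by rewrite mul_mpolyC scaleNr => /(JD _ _ fJ).
have sg : supported_on (saturation E) g.
  have [->|g0] := eqVneq g 0; first exact: supported0.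
  apply: IH => //; have := mlead_supp g0; rewrite gE mem_rem_uniq ?msupp_uniq //.
  by rewrite inE lt_neqAle => /andP[-> /msupp_le_mlead].
move=> m mf; have [-> //|ne] := eqVneq m (mlead f).
by apply: sg; rewrite gE mem_rem_uniq ?msupp_uniq // !inE ne.
Qed.

End MonomialIdeals.

(** * Graded families of exponent sets, domination and finite covers *)

Section GradedExponents.
Variable n : nat.
Implicit Types (F E : nat -> set 'X_{1..n}) (G : set 'X_{1..n}) (a b m : 'X_{1..n}).

Definition graded_exponents F : Prop :=
  [/\ F 0%N = setT, forall k, upset (F k) &
      forall p q a b, F p a -> F q b -> F (p + q)%N (a + b)%MM].

(* For [k > 0] this says that [a / k] lies in the rational points of [1/c]
   times the convex hull of [G], for every [a] in [F k]. *)
Definition dominated F G (c : nat) : Prop :=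
  forall k a, F k a -> exists2 q, (0 < q)%N & sumset G (q * k) (a *+ (q * c))%MM.

(** This is what finite generation of the ideal of positive [t]-degree leaves on exponents. *)
Definition splits_above F (N : nat) : Prop :=
  forall k a, (N < k)%N -> F k a -> exists j b d,
    [/\ (0 < j <= N)%N, F j b, F (k - j)%N d & a = (b + d)%MM].

Lemma sumset_graded F k q : graded_exponents F -> sumset (F k) q `<=` F (q * k)%N.
Proof.
move=> [F0 _ FD]; elim: q => [|q IH]; first by rewrite F0.
by move=> _ [a ka [b /IH kb <-]]; rewrite mulSn; exact: FD.
Qed.

Lemma saturation_graded F : graded_exponents F ->
  graded_exponents (fun k => saturation (F k)).
Proof.
move=> [F0 uF FD]; split.
- by apply/seteqP; split=> // m _; exists 1%N => //; rewrite F0; exact/sumset1.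
- by move=> k; exact: saturation_up.
- move=> p q a b [s s0 sa] [t t0 tb]; exists (s * t)%N; first by rewrite muln_gt0 s0.
  have uD : forall k x y, sumset (F p) k x -> sumset (F q) k y ->
      sumset (F (p + q)%N) k (x + y)%MM.
    elim=> [//|k IH] _ _ [x px [y py <-]] [u pu [v pv <-]].
    have -> : (x + y + (u + v) = (x + u) + (y + v))%MM.
      by apply/mnmP => i; rewrite !mnmDE; lia.
    by exists (x + u)%MM; [exact: FD|exists (y + v)%MM => //; exact: IH].
  rewrite mulmDr; apply: uD; first by rewrite mulmM; exact: sumset_scale.
  by rewrite mulnC mulmM; exact: sumset_scale.
Qed.

Lemma dominated_saturation F G c : graded_exponents F ->
  dominated F G c -> dominated (fun k => saturation (F k)) G c.
Proof.
move=> Fg FG k a [q q0 /(sumset_graded Fg) /FG [t t0 ta]].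
exists (t * q)%N; first by rewrite muln_gt0 t0.
by rewrite -mulnA; congr (sumset G _ _): ta; rewrite -mulmM; congr mnm_muln; lia.
Qed.

(** A degree [k] with [0 < k <= N] divides [N!], so multiples of its exponents reach [E N!]; higher
    degrees are split and the two bounds added over a common multiple. [F] is separate from [E] so
    that it can be the saturated family. *)
Lemma splits_dominated E F N : graded_exponents E ->
    (forall k, (0 < k)%N -> F k `<=` saturation (E k)) ->
  splits_above F N -> dominated F (E N`!) N`!.
Proof.
move=> Eg FE Fs; have [E0 uE ED] := Eg; set c := N`!.
elim/ltn_ind => k IH a ka.
case: k => [|k] in IH ka *; first by exists 1%N => //; rewrite muln0.
have [kN|Nk] := leqP k.+1 N.
  have [q q0 qa] := FE k.+1 isT a ka; exists q => //.
  have kc : (k.+1 %| c)%N by rewrite dvdn_fact.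
  have -> : (a *+ (q * c) = ((a *+ q) *+ (c %/ k.+1)) *+ k.+1)%MM.
    by rewrite -!mulmM divnK.
  apply: sumset_scale => //.
  have : sumset (sumset (E k.+1) (c %/ k.+1)) q ((a *+ q) *+ (c %/ k.+1))%MM.
    by apply: sumset_div; exact: sumset_scale.
  apply: sumset_mono => x /(sumset_graded Eg); by rewrite divnK.
have [j [b [d [/andP[j0 jN] jb kd ->]]]] := Fs _ _ Nk ka.
have [q q0 qb] := IH j (leq_ltn_trans jN Nk) b jb.
have [|t t0 td] := IH (k.+1 - j)%N _ d kd; first by rewrite ltn_subrL j0.
exists (q * t)%N; first by rewrite muln_gt0 q0.
have -> : (q * t * k.+1 = q * j * t + t * (k.+1 - j) * q)%N.
  have jk : (j <= k.+1)%N by lia.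
  by rewrite -{1}(subnKC jk); lia.
rewrite mulmDr; apply: sumsetD => //.
  have -> : (q * t * c = q * c * t)%N by lia.
  by rewrite mulmM; apply: sumset_scale.
have -> : (q * t * c = t * c * q)%N by lia.
by rewrite mulmM; apply: sumset_scale.
Qed.

(* With [r] generators of [G] and [k > r c], some generator occurs at least
   [q c] times in [q c a], so it can be subtracted from [a]. *)
Lemma dominated_finite_cover F G c : (0 < c)%N -> upset G -> dominated F G c ->
  exists (r : nat) (g : 'I_r -> 'X_{1..n}) (Y : seq (nat * 'X_{1..n})),
  (forall i, G (g i)) /\
  forall k a, F k a -> exists y (e : 'I_r -> nat) b,
    [/\ y \in Y, k = (y.1 + (\sum_i e i) * c)%N &
        a = (y.2 + (\sum_i g i *+ e i) + b)%MM].
Proof.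
move=> c0 uG FG; have [r [g [gG Gg]]] := upset_generators uG.
(* The induction runs on [B] rather than [F]: removing a generator of [G] together with [c] degrees
   stays in [B], but could leave [F]. *)
pose B k : set 'X_{1..n} :=
  [set a | exists2 q, (0 < q)%N & sumset G (q * k) (a *+ (q * c))%MM].
have [k _|s sP] := @seq_choice _ _ (iota 0 (r * c).+1)
  (fun k s => forall a, B k a -> exists2 y, y \in s & (y <= a)%MM).
  have [s _ sP] := dickson (fun (i : 'I_n) m => m i) (B k).
  by exists s => a /sP [y ys ya]; exists y => //; apply/mnm_lepP.
exists r, g, [seq (k, y) | k <- iota 0 (r * c).+1, y <- s k]; split => // k a /FG.
elim/ltn_ind: k a => k IH a Ba.
have [kr|rk] := leqP k (r * c).
  have kI : k \in iota 0 (r * c).+1 by rewrite mem_iota.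
  have [y ys ya] := sP k kI a Ba.
  exists (k, y), (fun=> 0%N), (a - y)%MM; split.
  - by apply/allpairsPdep; exists k, y.
  - by rewrite big1 //= addn0.
  - by rewrite big1 // addm0 addmC submK.
have [q q0 /(sumset_generators _ _ uG gG Gg) [e eq ea]] := Ba.
have [i ei] : exists i, (q * c < e i)%N.
  apply/existsP; rewrite -[X in is_true X]negbK negb_exists; apply/negP => /forallP H.
  have : (\sum_i e i <= \sum_(i < r) q * c)%N.
    by apply: leq_sum => i _; rewrite leqNgt.
  rewrite eq sum_nat_const card_ord mulnCA leq_pmul2l //; lia.
have ga : (g i <= a)%MM.
  apply/mnm_lepP => j; have := ea j;
    rewrite (bigD1 i) //= mulmnE => /(leq_trans (leq_addr _ _)).
  have qc : (0 < q * c)%N by rewrite muln_gt0 q0.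
  move=> H; rewrite -(leq_pmul2r qc) (leq_trans _ H) // mulnC leq_mul2r ltnW ?orbT //.
have ck : (c <= k)%N.
  have r0 : (0 < r)%N by exact: leq_ltn_trans (leq0n i) (ltn_ord i).
  by apply: leq_trans (ltnW rk); exact: leq_pmull.
have [||y [e' [b [yY kE aE]]]] := IH (k - c)%N _ (a - g i)%MM; first lia.
  exists q => //; apply/(sumset_generators _ _ uG gG Gg).
  exists (fun j => e j - (j == i) * (q * c))%N.
    rewrite sumnB => [|j _]; last by case: eqP => [->|//]; rewrite mul1n ltnW.
    rewrite eq (bigD1 i) //= eqxx big1 => [|j /negPf -> //].
    by rewrite mul1n addn0 mulnBr.
  move=> j; rewrite mulmnE mnmBE.
  under eq_bigr do rewrite mulnBl.
  rewrite sumnB => [|l _]; last by case: eqP => [->|//];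
    rewrite leq_mul2r mul1n ltnW ?orbT.
  have := ea j; rewrite mulmnE mulnBl [X in (_ - X <= _)%N](bigD1 i) //= eqxx.
  rewrite [X in (_ - (_ + X) <= _)%N]big1 => [|l /negPf -> //].
  by rewrite mul1n addn0 mulnC => H;
    rewrite [(g i j * _)%N]mulnC leq_sub2r // [X in (_ <= X)%N]mulnC.
exists y, (fun j => e' j + (j == i))%N, b; split => //.
  have s1 : (\sum_(l < r) (l == i) = 1)%N.
    by rewrite (bigD1 i) //= eqxx big1 // => l /negPf ->.
  by rewrite big_split /= s1 mulnDl mul1n addnA -kE subnK.
rewrite -(submK ga) aE; apply/mnmP => j; rewrite !mnmDE !mnm_sumE.
under [X in _ = (_ + X + _)%N]eq_bigr do rewrite mulmDl mnmDE.
rewrite big_split /= [X in _ = (_ + (_ + X) + _)%N](bigD1 i) //= eqxx mulm1n.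
rewrite [X in _ = (_ + (_ + (_ + X)) + _)%N]big1 => [|l /negPf ->]; first lia.
by rewrite mulm0n mnm0E.
Qed.

(** Divisibility is taken inside the Rees algebra: the quotient has to lie in [F]. Dickson's lemma
    is applied to the coordinates of the finite cover; for equal elements of [Y] the quotient is a
    sum of generators of [G] plus a free exponent. *)
Lemma dominated_divisor_basis F G c (T : set (nat * 'X_{1..n})) :
    graded_exponents F -> (0 < c)%N -> upset G -> G `<=` F c -> dominated F G c ->
    (forall x, T x -> F x.1 x.2) ->
  exists2 s : seq (nat * 'X_{1..n}), (forall x, x \in s -> T x) &
    forall x, T x -> exists u, [/\ u \in s, (u.1 <= x.1)%N, (u.2 <= x.2)%MM &
      F (x.1 - u.1)%N (x.2 - u.2)%MM].
Proof.
move=> Fg c0 uG GF FG TF; have [F0 uF FD] := Fg.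
have [r [g [Y [gG YP]]]] := dominated_finite_cover c0 uG FG.
have /choice [w wP] : forall x : nat * 'X_{1..n},
    exists w : (nat * 'X_{1..n}) * ('I_r -> nat) * 'X_{1..n}, T x ->
    [/\ w.1.1 \in Y, x.1 = (w.1.1.1 + (\sum_i w.1.2 i) * c)%N &
        x.2 = (w.1.1.2 + (\sum_i g i *+ w.1.2 i) + w.2)%MM].
  move=> x; have [Tx|nTx] := pselect (T x); last first.
    by exists ((0%N, 0%MM), (fun=> 0%N), 0%MM).
  by have [y [e [b H]]] := YP _ _ (TF x Tx); exists (y, e, b).
(* Two inequalities of opposite direction force the index in [Y] to agree. *)
pose code (t : bool + 'I_r + 'I_n) x : nat :=
  match t with
  | inl (inl true) => index (w x).1.1 Y
  | inl (inl false) => (size Y - index (w x).1.1 Y)%N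
  | inl (inr i) => (w x).1.2 i
  | inr j => (w x).2 j
  end.
have [s sT sP] := dickson code T; exists s => // x Tx.
have [u us ux] := sP x Tx; exists u.
have [uY u1 u2] := wP u (sT u us); have [xY x1 x2] := wP x Tx.
have yE : (w u).1.1 = (w x).1.1.
  have := ux (inl (inl true)); have := ux (inl (inl false)) => /= le1 le2.
  rewrite -(nth_index (w u).1.1 uY) -[RHS](nth_index (w u).1.1 xY); congr nth.
  move: uY xY; rewrite -!index_mem; move: le1 le2.
  by move: (index (w u).1.1 Y) (index (w x).1.1 Y) (size Y) => i1 i2 l; lia.
have le i : ((w u).1.2 i <= (w x).1.2 i)%N by exact: (ux (inl (inr i))).
have leb j : ((w u).2 j <= (w x).2 j)%N by exact: (ux (inr j)).
have lesum : (\sum_i (w u).1.2 i <= \sum_i (w x).1.2 i)%N by exact: leq_sum.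
have leg j : (\sum_i (g i j * (w u).1.2 i) <= \sum_i (g i j * (w x).1.2 i))%N.
  by apply: leq_sum => i _; rewrite leq_mul2l le orbT.
split=> //.
- by rewrite u1 x1 yE leq_add2l leq_mul2r lesum orbT.
- apply/mnm_lepP => j; rewrite u2 x2 yE !mnmDE !mnm_sumE.
  under eq_bigr do rewrite mulmnE;
    under [X in (_ <= _ + X + _)%N]eq_bigr do rewrite mulmnE.
  by rewrite !leq_add.
- have -> : (x.1 - u.1 = (\sum_i ((w x).1.2 i - (w u).1.2 i)) * c)%N.
    by rewrite sumnB // x1 u1 yE subnDl mulnBl.
  have : sumset G (\sum_i ((w x).1.2 i - (w u).1.2 i))
      (\sum_i g i *+ ((w x).1.2 i - (w u).1.2 i))%MM.
    elim/big_rec2: _ => [//|i y1 y2 _ H]; apply: sumsetD => //.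
    rewrite -[X in sumset _ X]mul1n; apply: sumset_scale => //; exact/sumset1.
  move/(sumset_mono GF)/(sumset_graded Fg) => H; apply: (upset_le (uF _) H).
  apply/mnm_lepP => j; rewrite mnmBE x2 u2 yE !mnmDE !mnm_sumE.
  under eq_bigr do rewrite mulmnE mulnBr.
  under [X in (_ <= (_ + X + _) - _)%N]eq_bigr do rewrite mulmnE.
  under [X in (_ <= _ - (_ + X + _))%N]eq_bigr do rewrite mulmnE.
  rewrite sumnB => [|i _]; last by rewrite leq_mul2l le orbT.
  by have := leg j; have := leb j; lia.
Qed.

End GradedExponents.

(** * Noetherianity of Rees algebras of monomial families *)

Section MonomialReesAlgebra.
Variables (K : fieldType) (n : nat) (F : nat -> set 'X_{1..n}).
Hypothesis Fg : graded_exponents F.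

Let S : set {poly {mpoly K[n]}} := rees_algebra (fun k => supported_on (F k)).

Let S_subring : [/\ S 1,
  forall f g, S f -> S g -> S (f - g) & forall f g, S f -> S g -> S (f * g)].
Proof.
have [F0 uF FD] := Fg; apply: rees_algebra_subring.
- by move=> k; exact: supported_ideal.
- by rewrite F0 supported_setT.
- by move=> p q f g; apply: supportedM => a b; exact: FD.
Qed.

Let S0 : S 0.
Proof. by case: S_subring => S1 SB _; rewrite -(subrr 1); exact: SB. Qed.

Let SD f g : S f -> S g -> S (f + g).
Proof.
case: S_subring => _ SB _ fS gS; rewrite -[g]opprK -[- g]sub0r.
by apply: (SB) => //; exact: SB.
Qed.

Let SM f g : S f -> S g -> S (f * g).
Proof. by case: S_subring => _ _; apply. Qed.

Lemma rees_monomial (c : K) k a : F k a -> S ((c *: 'X_[a]) *: 'X^k).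
Proof.
move=> ka j; rewrite coefZ coefXn; case: eqP => [->|_]; last first.
  by rewrite mulr0; exact: supported0.
by rewrite mulr1 => m /msuppZ_le; rewrite msuppX inE => /eqP ->.
Qed.

(** A monomial whose degree exceeds those of the generators of the ideal of positive [t]-degree must
    have a factor of positive degree at most [N]. *)
Lemma noetherian_splits : noetherian_subring S -> exists N, splits_above F N.
Proof.
have [F0 uF FD] := Fg => noeth.
pose J : set {poly {mpoly K[n]}} := [set p | S p /\ p`_0 = 0].
have [|s Js] := noeth J.
  split.
  - by move=> p [].
  - by split; rewrite ?coef0.
  - by move=> p q [Sp p0] [Sq q0]; split; [exact: SD|rewrite coefD p0 q0 addr0].
  - by move=> f p Sf [Sp p0]; split; [exact: SM|rewrite coef0M p0 mulr0].
have sJ p : p \in s -> J p by rewrite Js => ps; apply: sub_gen_smallest.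
pose N := \max_(p <- s) size p; exists N => k a Nk ka.
pose split_exp k := [set a | exists j b d,
    [/\ (0 < j <= N)%N, F j b, F (k - j)%N d & a = (b + d)%MM]].
(* [T] is an ideal of [S]. It contains the generators because their coefficients above [N] vanish,
   so it contains all of [J]. *)
pose T : set {poly {mpoly K[n]}} := [set p |
  [/\ S p, p`_0 = 0 & forall k, (N < k)%N -> supported_on (split_exp k) p`_k]].
suff : T (1 *: 'X_[a] *: 'X^k).
  case=> _ _ /(_ k Nk); rewrite coefZ coefXn eqxx mulr1 scale1r.
  by apply; rewrite msuppX inE.
have : J (1 *: 'X_[a] *: 'X^k).
  split; first exact: rees_monomial.
  by rewrite coefZ coefXn; case: k Nk {ka} => [//|k _]; rewrite mulr0.
rewrite Js; apply: smallest_sub => {k a Nk ka} [|p /= ps]; last first.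
  have [Sp p0] := sJ p ps; split=> // k Nk; rewrite nth_default;
    first exact: supported0.
  by rewrite (leq_trans _ (ltnW Nk)) // /N (@leq_bigmax_seq _ s xpredT (fun p =>
    size p)).
split=> //.
- by move=> p [].
- by split=> // [|k _]; rewrite coef0 //; exact: supported0.
- move=> p q [Sp p0 pT] [Sq q0 qT]; split; first exact: SD.
    by rewrite coefD p0 q0 addr0.
  by move=> k Nk; rewrite coefD; apply: supportedD; [exact: pT|exact: qT].
- move=> f p Sf [Sp p0 pT]; split; first exact: SM.
    by rewrite coef0M p0 mulr0.
  move=> k Nk; rewrite coefMr; apply: supported_sum => -[i /= ik] _.
  case: i => [|i] in ik *; first by rewrite p0 mulr0; exact: supported0.
  (* In low degree the monomial of [p] is itself the factor to split off; otherwise it already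
     splits, and the monomial of [f] joins its second part. *)
  have [iN|Ni] := leqP i.+1 N.
    apply: supportedM (Sf (k - i.+1)%N) (Sp i.+1) => d b kd ib.
    by exists i.+1, b, d; split=> //; rewrite addmC.
  apply: supportedM (Sf (k - i.+1)%N) (pT _ Ni) =>
    d b kd [j [b' [d' [jN jb' id' ->]]]].
  exists j, b', (d' + d)%MM; split => //; last by rewrite addmC addmA.
  have -> : (k - j = (i.+1 - j) + (k - i.+1))%N by lia.
  exact: FD.
Qed.

(* Division with remainder by elements of [J] whose leading monomials (for the
   order comparing the [t]-degree first) generate all those of [J]. *)
Lemma dominated_noetherian G c : (0 < c)%N -> upset G -> G `<=` F c ->
  dominated F G c -> noetherian_subring S.
Proof.
move=> c0 uG GF FG J [JS J0 JD JM]; have [F0 uF FD] := Fg.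
(* Leading data of the elements of [J]: the top [t]-degree, then the leading exponent of the
   coefficient found there. *)
pose T : set (nat * 'X_{1..n}) := [set x | exists p,
  [/\ J p, (size p <= x.1.+1)%N, p`_x.1 != 0 & mlead p`_x.1 = x.2]].
have TF x : T x -> F x.1 x.2.
  by move=> [p [Jp _ p0 <-]]; apply: (JS p Jp); exact: mlead_supp.
have [s sT sP] := dominated_divisor_basis Fg c0 uG GF FG TF.
have [P PT] := seq_choice (Q := fun x (p : seq {poly {mpoly K[n]}}) =>
  exists p0, p = [:: p0] /\ [/\ J p0, (size p0 <= x.1.+1)%N, p0`_x.1 != 0
     & mlead p0`_x.1 = x.2]) (fun x xs =>
   let: ex_intro p pP := sT x xs in ex_intro _ [:: p] (ex_intro _ p (conj erefl pP))).
exists (flatten [seq P x | x <- s]); apply/seteqP; split; last first.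
  apply: smallest_sub; first by split.
  by move=> p /flatten_mapP [x /PT [q [-> [Jq _ _ _]]]]; rewrite inE => /eqP ->.
set Q := ideal_gen S _.
have [QS Q0 QD QM] : ideal_of S Q.
  apply: ideal_gen_ideal => // p /flatten_mapP [x /PT [q [-> [Jq _ _ _]]]].
  by rewrite inE => /eqP ->; exact: JS.
suff H k p : J p -> (size p <= k)%N -> Q p by move=> p Jp; exact: (H (size p)).
(* The outer induction is on the bound for the size of [p], the inner one on the leading exponent
   [a] of its coefficient of degree [k]. *)
elim: k p => [|k IHk] p Jp; first by rewrite leqn0 size_poly_eq0 => /eqP ->.
move: {2}(mlead p`_k) (erefl (mlead p`_k)) => a.
elim/(@ltmwf n): a p Jp => a IHa p Jp pa pk.
have small (q : {poly {mpoly K[n]}}) : (size q <= k.+1)%N -> q`_k = 0 ->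
  (size q <= k)%N.
  move=> qk q0; apply/leq_sizeP => j; rewrite leq_eqVlt => /orP[/eqP <- //|kj].
  by rewrite nth_default ?(leq_trans qk).
have [p0|pn0] := eqVneq p`_k 0; first by apply: IHk => //; exact: small.
have [|u [us uk ua uF']] := sP (k, a); first by exists p.
have [q [Pu [Jq qk q0 qa]]] := PT u us.
have Qq : Q q.
  by apply: sub_gen_smallest; apply/flatten_mapP; exists u => //; rewrite Pu mem_head.
rewrite /= in uk ua uF'.
(* [l] and [M] are chosen so that [M * q] has the same leading term as [p]; subtraction lowers the
   size or the leading exponent. *)
pose l := mleadc p`_k / mleadc q`_u.1.
pose M : {poly {mpoly K[n]}} := (l *: 'X_[(a - u.2)%MM]) *: 'X^(k - u.1).
have SMM : S M by exact: rees_monomial.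
have Mk : (M * q)`_k = l *: 'X_[(a - u.2)%MM] * q`_u.1.
  rewrite -scalerAl coefZ; congr (_ * _).
  by rewrite coefXnM ltnNge leq_subr /= subKn.
have sMq : (size (M * q)%R <= k.+1)%N.
  apply/leq_sizeP => j kj; rewrite -scalerAl coefZ coefXnM.
  case: ltnP => _; first by rewrite mulr0.
  by rewrite nth_default ?mulr0 // (leq_trans qk) //; move: uk kj;
    move: (u.1) => i; lia.
pose p' := p - M * q.
have Jp' : J p'.
  by apply: JD => //; rewrite -mulNr; apply: JM => //; rewrite -sub0r;
    case: S_subring => _ SB _; apply: SB.
have sp' : (size p' <= k.+1)%N.
  by rewrite (leq_trans (size_polyD _ _)) // size_polyN geq_max pk.
suff Qp' : Q p' by rewrite -(subrK (M * q) p); apply: QD => //; exact: QM.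
have [p'0|p'n0] := eqVneq p'`_k 0; first by apply: IHk => //; exact: small.
apply: (IHa (mlead p'`_k)) => //.
have ln0 : l != 0 by rewrite mulf_neq0 // ?invr_eq0 mleadc_eq0.
have Mn0 : l *: 'X_[(a - u.2)%MM] != 0 :> {mpoly K[n]}.
  by rewrite scaler_eq0 negb_or ln0 /= -msupp_eq0 msuppX.
have mM : mlead (M * q)`_k = a.
  by rewrite Mk mleadM // mleadZ // mleadXm qa submK.
have cM : (M * q)`_k@_a = p`_k@_a.
  have {1}-> : a = (mlead (l *: 'X_[(a - u.2)%MM]) + mlead q`_u.1)%MM.
    by rewrite mleadZ // mleadXm qa submK.
  rewrite Mk mleadcM mleadZ // mcoeffZ mleadXm mcoeffX eqxx mulr1 /l pa mulfVK //.
  by rewrite mleadc_eq0.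
(* Only a weak inequality is available; equality is excluded since the coefficient at [a] cancels by
   [cM]. *)
have := mleadB_le p`_k (M * q)`_k; rewrite mM pa joinxx -coefB -/p'.
rewrite le_eqVlt => /orP[/eqP pE|//].
case/negP: p'n0; rewrite -mleadc_eq0 pE /p' coefB mcoeffB cM subrr //.
Qed.

End MonomialReesAlgebra.

(** * Convex sets, dilations and stability under the nonnegative orthant *)

Section ConvexSets.
Variables (R : realType) (n : nat).
Implicit Types (A G : set 'rV[R]_n) (x y z : 'rV[R]_n).

Lemma convex_setP A : @convex_set R 'rV[R]_n A <->
  (forall x y (t : R), A x -> A y -> 0 <= t <= 1 -> A (t *: x + (1 - t) *: y)).
Proof.
split=> [cA x y t Ax Ay /andP[t0 t1]|cA x y t].
  have := cA x y (Itv01 t0 t1); rewrite !inE => /(_ Ax Ay).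
  by [].
rewrite !inE => Ax Ay; have /= := cA x y t%:num Ax Ay.
by apply; apply/andP; split.
Qed.

Lemma convex_hull_convex G : @convex_set R 'rV[R]_n (convex_hull G).
Proof.
apply/convex_setP => x y t xG yG t01 A [cA GA].
by have /convex_setP := cA; apply => //; [exact: xG|exact: yG].
Qed.

Lemma convex_hull_sub A G : @convex_set R 'rV[R]_n A -> G `<=` A ->
  convex_hull G `<=` A.
Proof. exact: smallest_sub. Qed.

Lemma sub_convex_hull G : G `<=` convex_hull G.
Proof. exact: sub_gen_smallest. Qed.

Lemma dilateE (c : R) A x : c != 0 -> dilate c A x <-> A (c^-1 *: x).
Proof.
move=> c0; split=> [[y Ay <-]|Ax]; first by rewrite scalerA mulVf // scale1r.
by exists (c^-1 *: x) => //; rewrite scalerA mulfV // scale1r.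
Qed.

Lemma dilate_convex (c : R) A :
  @convex_set R 'rV[R]_n A -> @convex_set R 'rV[R]_n (dilate c A).
Proof.
move=> /convex_setP cA; apply/convex_setP => _ _ t [x Ax <-] [y Ay <-] t01.
exists (t *: x + (1 - t) *: y); first exact: cA.
by rewrite scalerDr !scalerA ![c * _]mulrC.
Qed.

Lemma convex_sum (I : finType) (l : I -> R) (v : I -> 'rV[R]_n) A :
    @convex_set R 'rV[R]_n A -> (forall i, 0 <= l i) -> \sum_i l i = 1 ->
  (forall i, A (v i)) -> A (\sum_i l i *: v i).
Proof.
move=> /convex_setP cA l0 l1 vA.
(* Partial sums need not have weight 1, so the invariant records the weight [w] and normalises by
   it; weight 0 forces the sum to be 0. *)
pose P (w : R) x := 0 <= w /\ if w == 0 then x = 0 else A (w^-1 *: x).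
suff : P (\sum_i l i) (\sum_i l i *: v i).
  by rewrite l1; case=> _; rewrite oner_eq0 invr1 scale1r.
elim/big_ind2: _ => [|x1 w1 x2 w2|i _].
- by split; rewrite ?eqxx.
- move=> [w10 H1] [w20 H2]; split; first exact: addr_ge0.
  case: (eqVneq w1 0) H1 => [-> ->|w1n H1]; first by rewrite !add0r.
  case: (eqVneq w2 0) H2 => [-> ->|w2n H2]; first by rewrite !addr0 (negPf w1n).
  have w1p : 0 < w1 by rewrite lt_neqAle eq_sym w1n.
  have w2p : 0 < w2 by rewrite lt_neqAle eq_sym w2n.
  have wp : 0 < w1 + w2 by exact: addr_gt0.
  have wn : w1 + w2 != 0 by rewrite gt_eqF.
  rewrite (negPf wn).
  have tw : 0 <= w1 / (w1 + w2) <= 1.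
    by apply/andP; split; [exact: divr_ge0 w10 (ltW wp)|rewrite ler_pdivrMr //
      mul1r lerDl].
  have := cA _ _ _ H1 H2 tw.
  by congr A; rewrite scalerDr !scalerA; congr (_ *: _ + _ *: _); field;
    rewrite ?w1n ?w2n ?wn.
- split=> //; case: eqVneq => [->|ln0]; first by rewrite scale0r.
  by rewrite scalerA mulVf // scale1r.
Qed.

Definition orthant_closed A := forall x y, A x -> (forall i, 0 <= y 0 i) -> A (x + y).

Lemma orthant_closed_axis A : (forall x i (s : R), A x -> 0 <= s ->
  A (x + s *: 'e_i)) ->
  orthant_closed A.
Proof.
move=> H x y Ax y0; rewrite [y]row_sum_delta;
  elim/big_rec: _ x Ax => [|i z _ IH] x Ax.
  by rewrite addr0.
by rewrite addrA; apply: IH; exact: H.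
Qed.

Lemma orthant_closed_dilate (c : R) A : 0 < c -> orthant_closed A ->
  orthant_closed (dilate c A).
Proof.
move=> c0 oA x y; have cn : c != 0 by rewrite gt_eqF.
move=> /(dilateE _ _ cn) Ax y0; apply/dilateE => //; rewrite scalerDr;
  apply: oA => // i.
by rewrite mxE mulr_ge0 // invr_ge0 ltW.
Qed.

End ConvexSets.

(** * Newton polyhedra and their lattice points *)

Section NewtonPolyhedra.
Variables (R : realType) (n : nat).
Implicit Types (E G : set 'X_{1..n}) (x y : 'rV[R]_n) (m a b : 'X_{1..n}).

Definition newton E : set 'rV[R]_n := convex_hull [set mnm_vec R m | m in E].

Lemma mnm_vecD a b : mnm_vec R (a + b)%MM = mnm_vec R a + mnm_vec R b.
Proof. by apply/rowP => i; rewrite !mxE mnmDE natrD. Qed.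

Lemma mnm_vecM a q : mnm_vec R (a *+ q)%MM = q%:R *: mnm_vec R a.
Proof. by apply/rowP => i; rewrite !mxE mulmnE natrM mulrC. Qed.

Lemma newton_convex E : @convex_set R 'rV[R]_n (newton E).
Proof. exact: convex_hull_convex. Qed.

Lemma mem_newton E m : E m -> newton E (mnm_vec R m).
Proof. by move=> Em; apply: sub_convex_hull; exists m. Qed.

Lemma newton_sub E (A : set 'rV[R]_n) : @convex_set R 'rV[R]_n A ->
  (forall m, E m -> A (mnm_vec R m)) -> newton E `<=` A.
Proof. by move=> cA EA; apply: convex_hull_sub => // _ [m /EA Am <-]. Qed.

Lemma newton_orthant_closed E : upset E -> orthant_closed (newton E).
Proof.
move=> uE; apply: orthant_closed_axis => x i s xE s0.
(* The translated condition is again convex, so it has to be checked only at the exponents in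
   [E]. *)
pose A : set 'rV[R]_n := [set x | newton E (x + s *: 'e_i)].
have /convex_setP cE := @newton_convex E.
suff : newton E `<=` A by apply.
apply: newton_sub.
  apply/convex_setP => u v t Au Av t01; rewrite /A /=.
  have -> : t *: u + (1 - t) *: v + s *: 'e_i =
      t *: (u + s *: 'e_i) + (1 - t) *: (v + s *: 'e_i).
    have tt : t + (1 - t) = 1 by ring.
    by rewrite !scalerDr [RHS]addrACA -[in RHS]scalerDl tt scale1r.
  exact: cE.
move=> m Em; rewrite /A /=.
(* For an integer [N > s] the shifted point lies on the segment from [m] to [m + U_(i) *+ N], both
   of which are in [E]. *)
pose N := (Num.trunc s).+1; have sN : s < N%:R by exact: truncnS_gt.
have Np : 0 < N%:R :> R by rewrite ltr0n.
have := cE (mnm_vec R (m + U_(i) *+ N)%MM) (mnm_vec R m) (s / N%:R).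
have Nn : N%:R != 0 :> R by rewrite gt_eqF.
rewrite divr_ge0 ?ler0n // ler_pdivrMr // mul1r (ltW sN).
move=> /(_ (mem_newton (uE _ _ Em)) (mem_newton Em) isT); congr newton.
have tt : s / N%:R + (1 - s / N%:R) = 1 by ring.
rewrite mnm_vecD mnm_vecM scalerDr !scalerA divfK // addrAC -scalerDl tt scale1r.
congr (_ + _ *: _); apply/rowP => j.
by rewrite !mxE mnm1E eqxx eq_sym.
Qed.

Lemma sumset_newton E k a : upset E -> (0 < k)%N ->
  sumset E k a -> newton E (k%:R^-1 *: mnm_vec R a).
Proof.
move=> uE; case: k => [//|k] _; elim: k a => [|k IH] a.
  by move/(sumset1 _ uE) => Ea; rewrite invr1 scale1r; exact: mem_newton.
move=> [x Ex [y ky <-]]; rewrite mnm_vecD.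
have /convex_setP cE := @newton_convex E.
have := cE _ _ (k.+2%:R^-1) (mem_newton Ex) (IH y ky).
rewrite invr_ge0 ler0n invf_le1 ?ltr0n // ler1n => /(_ isT); congr newton.
suff e : (1 - k.+2%:R^-1) * k.+1%:R^-1 = k.+2%:R^-1 :> R by rewrite scalerDr
  scalerA e.
rewrite -[k.+2%:R]natr1; field.
by rewrite nat1r natr1 !pnatr_eq0.
Qed.

Lemma saturation_newton E m : upset E -> saturation E m -> newton E (mnm_vec R m).
Proof.
move=> uE [q q0 /(sumset_newton uE q0)]; rewrite mnm_vecM scalerA mulVf ?scale1r //.
by rewrite pnatr_eq0 -lt0n.
Qed.

(* Rounding down the coefficients of a convex combination loses a bounded
   number of summands. *)
Lemma newton_floor E x : upset E -> newton E x ->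
  exists d, forall N, exists2 e, sumset E (N - d) e &
    forall j, (e j)%:R <= N%:R * x 0 j.
Proof.
move=> uE; pose Z : set 'rV[R]_n := [set x | exists d, forall N, exists2 e,
  sumset E (N - d) e & forall j, (e j)%:R <= N%:R * x 0 j].
suff : newton E `<=` Z by apply.
apply: newton_sub => [|m Em]; last first.
  exists 0%N => N; exists (m *+ N)%MM => [|j]; last by rewrite mxE mulmnE natrM mulrC.
  by rewrite subn0 -[X in sumset _ X]mul1n; apply: sumset_scale => //; exact/sumset1.
(* Nonnegative coordinates let the bounds on [N1] and [N2] be multiplied by the coordinates of [u]
   and [v]. *)
have Z0 u : Z u -> forall j, 0 <= u 0 j.
  move=> [d /(_ 1%N) [e _ eu]] j; have := eu j; rewrite mul1r; exact: le_trans.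
apply/convex_setP => u v t Zu Zv /andP[t0 t1].
(* The extra 1 pays for truncating both [N t] and [N (1 - t)]: the two integer parts add up to at
   least [N - 1]. *)
have [[d1 H1] [d2 H2]] := (Zu, Zv); exists (d1 + d2 + 1)%N => N.
have t1' : 0 <= 1 - t by rewrite subr_ge0.
pose N1 := Num.trunc (N%:R * t); pose N2 := Num.trunc (N%:R * (1 - t)).
have /andP[N1l N1u] : N1%:R <= N%:R * t < N1.+1%:R by apply: truncn_itv;
  exact: mulr_ge0.
have /andP[N2l N2u] : N2%:R <= N%:R * (1 - t) < N2.+1%:R.
  by apply: truncn_itv; exact: mulr_ge0.
have NN : (N <= N1 + N2 + 1)%N.
  rewrite -ltnS -(ltr_nat R) (_ : (N1 + N2 + 1).+1 = N1.+1 + N2.+1)%N ?natrD;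
    last lia.
  have -> : N%:R = N%:R * t + N%:R * (1 - t) :> R by ring.
  exact: ltrD.
have [e1 e1E e1u] := H1 N1; have [e2 e2E e2v] := H2 N2.
exists (e1 + e2)%MM.
  apply: (sumset_le uE _ (sumsetD uE e1E e2E)); lia.
move=> j; rewrite mnmDE natrD !mxE mulrDr !mulrA; apply: lerD.
  by apply: (le_trans (e1u j)); apply: ler_wpM2r => //; exact: Z0.
by apply: (le_trans (e2v j)); apply: ler_wpM2r => //; exact: Z0.
Qed.

(** Rounding at [k * M] bounds [m *+ M] from below by a sum of [k * M - d] exponents. Since
    [d <= d * k], these form at least [M - d] groups of [k], and the asymptotic criterion
    applies. *)
Lemma newton_saturation E k m : upset E -> (0 < k)%N ->
  newton E (k%:R^-1 *: mnm_vec R m) -> saturation (sumset E k) m.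
Proof.
move=> uE k0 /(newton_floor uE) [d H].
apply: (asymptotic_saturation (d := d)) => [|M]; first exact: sumset_up.
have [e eE em] := H (k * M)%N; apply: sumset_div.
apply: (upset_le (sumset_up uE)) (sumset_le uE _ eE) _.
  by rewrite mulnBl mulnC leq_sub2l // leq_pmulr.
apply/mnm_lepP => j; rewrite mulmnE -(ler_nat R) (le_trans (em j)) //.
rewrite !mxE !natrM mulrACA mulfV ?mul1r ?[_ * M%:R]mulrC // pnatr_eq0 -lt0n //.
Qed.

End NewtonPolyhedra.

Arguments newton R {n} E.

(** * Half-spaces, Fourier-Motzkin elimination and vertices of polyhedra *)

Section Polyhedra.
Variables (R : realType) (n : nat).
Implicit Types (P Q G : set 'rV[R]_n) (x y : 'rV[R]_n).

Definition dot (a x : 'rV[R]_n) : R := \sum_i a 0 i * x 0 i.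

Lemma dotDr a x y : dot a (x + y) = dot a x + dot a y.
Proof. by rewrite -big_split; apply: eq_bigr => i _; rewrite mxE mulrDr. Qed.

Lemma dotZr a (t : R) x : dot a (t *: x) = t * dot a x.
Proof. by rewrite mulr_sumr; apply: eq_bigr => i _; rewrite mxE mulrCA. Qed.

Lemma dotNr a x : dot a (- x) = - dot a x.
Proof. by rewrite -scaleN1r dotZr mulN1r. Qed.

Lemma dotDl a b x : dot (a + b) x = dot a x + dot b x.
Proof. by rewrite -big_split; apply: eq_bigr => i _; rewrite mxE mulrDl. Qed.

Lemma dotZl a (t : R) x : dot (t *: a) x = t * dot a x.
Proof. by rewrite mulr_sumr; apply: eq_bigr => i _; rewrite mxE mulrA. Qed.

Lemma dot0l x : dot 0 x = 0.
Proof. by rewrite -(scale0r 0) dotZl mul0r. Qed.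

Lemma dot_delta i x : dot 'e_i x = x 0 i.
Proof.
rewrite /dot (bigD1 i) //= mxE !eqxx mul1r big1 ?addr0 // => j /negPf ji.
by rewrite mxE ji andbF mul0r.
Qed.

Lemma closure_rowP G x : closure G x <->
  forall e : R, 0 < e -> exists2 y, G y & forall j, `|x 0 j - y 0 j| < e.
Proof.
split=> [Gx e e0|H B [P Px PB]].
  have [|y [Gy By]] := Gx [set y : 'rV[R]_n | forall j, ball (x 0 j) e (y 0 j)].
    exists (fun i j => ball (x i j) e); first by move=> i j; exact: nbhsx_ballx.
    by move=> y By j; exact: By.
  by exists y => // j; exact: By.
have /choice [e eP] : forall j, exists e : R, 0 < e /\ ball (x 0 j) e `<=` P 0 j.
  by move=> j; have /nbhs_ballP [e e0 eP] := Px 0 j; exists e.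
(* The least of finitely many radii, with 1 as the default when there is no coordinate. *)
have [|y Gy xy] := H (\big[Num.min/1]_j e j).
  by elim/big_ind: _ => // [u v u0 v0|i _]; [rewrite lt_min u0|case: (eP i)].
exists y; split => //; apply: PB => i j; rewrite ord1.
have [_] := eP j; apply; apply: (lt_le_trans (xy j)).
by rewrite (bigD1 j) //= ge_min lexx.
Qed.

Lemma halfspace_closed P : halfspace P -> closure P `<=` P.
Proof.
move=> [a [b [_ ->]]] x /closure_rowP H; rewrite /= -/(dot a x).
rewrite leNgt; apply/negP => bx.
(* [s] is a Lipschitz constant of [dot a] for the maximum norm; dividing by [s + 1] avoids a zero
   divisor. *)
pose s := \sum_i `|a 0 i|; have s0 : 0 <= s by exact: sumr_ge0.
have s1 : 0 < s + 1 by rewrite ltr_wpDl.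
have [|y] := H ((dot a x - b) / (s + 1)); first by rewrite divr_gt0 // subr_gt0.
rewrite /= -/(dot a y) => yb xy.
have : dot a (x - y) <= s * ((dot a x - b) / (s + 1)).
  rewrite mulr_suml; apply: ler_sum => i _.
  rewrite (le_trans (ler_norm _)) // normrM !mxE ler_wpM2l // ltW //; exact: xy.
rewrite dotDr dotNr mulrA ler_pdivlMr // => H1.
have : 0 < dot a x - b by rewrite subr_gt0.
nra.
Qed.

Lemma polyhedron_closed P : polyhedron P -> closure P `<=` P.
Proof.
move=> [m [H [Hh ->]]] x xP i _; apply: halfspace_closed (Hh i) _ _.
by move=> B /xP [y [yP By]]; exists y; split => //; exact: yP.
Qed.

Lemma polyhedron_fin (C : finType) (H : C -> set 'rV[R]_n) :
  (forall c, halfspace (H c)) -> polyhedron [set x | forall c, H c x].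
Proof.
move=> Hh; exists #|C|, (fun i => H (enum_val i)); split=> //.
apply/seteqP; split=> x Hx; first by move=> i _; exact: Hx.
by move=> c; have := Hx (enum_rank c) Logic.I; rewrite enum_rankK.
Qed.

Section LinearSystems.
Hypothesis n_gt0 : (0 < n)%N.

(** A half-space has a nonzero normal, so constraints with [a c = 0] are treated apart: a
    contradictory one makes the set empty, written as [x_0 <= -1] and [- x_0 <= -1]; otherwise they
    hold trivially and are dropped. *)
Lemma polyhedron_system (C : finType) (a : C -> 'rV[R]_n) (b : C -> R) :
  polyhedron [set x | forall c, dot (a c) x <= b c].
Proof.
have [[c [ac bc]]|H] := pselect (exists c, a c = 0 /\ b c < 0).
  pose i0 := Ordinal n_gt0.
  have e0 : 'e_i0 != 0 :> 'rV[R]_n.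
    by apply/eqP => /rowP /(_ i0); rewrite !mxE !eqxx => /eqP; rewrite oner_eq0.
  have := @polyhedron_fin bool (fun s => [set x |
    dot (if s then 'e_i0 else - 'e_i0) x <= -1]).
  have -> : [set x | forall c, dot (a c) x <= b c] = [set x | forall s : bool,
    [set x | dot (if s then 'e_i0 else - 'e_i0) x <= -1] x].
    apply/seteqP; split=> x /=.
      by move/(_ c); rewrite ac dot0l leNgt bc.
    move=> Hx; have := Hx true; have := Hx false.
    rewrite /= -scaleN1r dotZl dot_delta; lra.
  apply=> -[]; first by exists 'e_i0, (-1).
  by exists (- 'e_i0), (-1); rewrite oppr_eq0.
have := @polyhedron_fin {c | a c != 0}
  (fun c => [set x | dot (a (val c)) x <= b (val c)]).
have -> : [set x | forall c, dot (a c) x <= b c] =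
    [set x | forall c : {c | a c != 0}, [set x | dot (a (val c)) x <= b (val c)] x].
  apply/seteqP; split=> x Hx c; first exact: Hx.
  have [ac|ac] := eqVneq (a c) 0; last exact: (Hx (Sub c ac)).
  rewrite ac dot0l leNgt; apply/negP => bc; apply: H; by exists c.
by apply=> c; exists (a (val c)), (b (val c)); split => //; exact: (valP c).
Qed.

End LinearSystems.

(** For the converse, [t] is the least upper bound imposed by the constraints with [u c > 0]; if
    there are none, the largest lower bound; if there is neither, 0. *)
Lemma eliminate_variable (C : finType) (u f : C -> R) :
  (exists t, forall c, u c * t + f c <= 0) <->
  (forall c, u c = 0 -> f c <= 0) /\
  (forall c d, 0 < u c -> u d < 0 -> u c * f d - u d * f c <= 0).
Proof.
split=> [[t H]|[H0 H]].
  split=> [c uc|c d uc ud]; first by have := H c; rewrite uc mul0r add0r.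
  by have := H c; have := H d; nra.
have [[c0 uc0]|npos] := pselect (exists c, 0 < u c).
  case: (@Order.TotalTheory.arg_minP _ _ _ c0 (fun c => 0 < u c) (fun c =>
    - f c / u c) uc0).
  move=> c uc cmin; exists (- f c / u c) => d.
  have [ud|ud|ud] := ltrgt0P (u d).
  - have := cmin d ud; rewrite ler_pdivlMr // => le; rewrite mulrC.
    by move: le; lra.
  - have := H c d uc ud; have -> : u c * f d - u d * f c = u c * (u d * (- f c / u
    c) + f d).
      by field; rewrite gt_eqF.
    by rewrite pmulr_rle0.
  - by rewrite ud mul0r add0r; exact: H0.
have [[c0 uc0]|nneg] := pselect (exists c, u c < 0).
  case: (@Order.TotalTheory.arg_maxP _ _ _ c0 (fun c => u c < 0) (fun c =>
    - f c / u c) uc0).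
  move=> c uc cmax; exists (- f c / u c) => d.
  have [ud|ud|ud] := ltrgt0P (u d).
  - by case: npos; exists d.
  - have le0 : - f d / u d <= - f c / u c := cmax d ud.
    move: le0; rewrite ler_ndivrMr // => le; rewrite mulrC.
    by move: le; lra.
  - by rewrite ud mul0r add0r; exact: H0.
exists 0 => c; rewrite mulr0 add0r; apply: H0.
have [uc|uc|//] := ltrgt0P (u c); [by case: npos; exists c|by case: nneg; exists c].
Qed.

(* Fourier-Motzkin: the [r] existentially quantified variables are eliminated
   one at a time. *)
Lemma polyhedron_projection (n_gt0 : (0 < n)%N) r (C : finType) (w : C -> nat -> R)
    (a : C -> 'rV[R]_n) (b : C -> R) :
  polyhedron [set x | exists l : nat -> R, forall c,
    \sum_(i < r) w c i * l i + dot (a c) x <= b c].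
Proof.
elim: r => [|r IH] in C w a b *.
  have -> : [set x | exists l : nat -> R, forall c,
    \sum_(i < 0) w c i * l i + dot (a c) x <= b c] = [set x | forall c,
      dot (a c) x <= b c].
    apply/seteqP; split=> x /=; first by move=> [l H] c; have := H c;
      rewrite big_ord0 add0r.
    by move=> H; exists (fun=> 0) => c; rewrite big_ord0 add0r.
  exact: polyhedron_system.
pose pos c d := (0 < w c r) && (w d r < 0).
(* Constraints free of the last variable are kept and pairs of opposite sign are combined; all other
   indices carry the trivial constraint [0 <= 0]. *)
have := IH (C + C * C)%type
  (fun e i => match e with
    | inl c => if w c r == 0 then w c i else 0
    | inr (c, d) => if pos c d then w c r * w d i - w d r * w c i else 0 end)
  (fun e => match e with
    | inl c => if w c r == 0 then a c else 0
    | inr (c, d) => if pos c d then w c r *: a d - w d r *: a c else 0 end)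
  (fun e => match e with
    | inl c => if w c r == 0 then b c else 0
    | inr (c, d) => if pos c d then w c r * b d - w d r * b c else 0 end).
congr polyhedron; apply/seteqP; split=> x /= [l H].
  pose f c := \sum_(i < r) w c i * l i + dot (a c) x - b c.
  have [|t tH] := (eliminate_variable (fun c => w c r) f).2.
    split=> [c wc|c d wc wd]; rewrite /f.
      by have := H (inl c); rewrite wc eqxx subr_le0.
    have := H (inr (c, d)); rewrite /pos wc wd /= dotDl dotZl -scaleNr dotZl.
    under eq_bigr do rewrite mulrBl -!mulrA; rewrite sumrB -!mulr_sumr; lra.
  exists (fun i => if (i == r)%N then t else l i) => c.
  rewrite big_ord_recr /= eqxx; have := tH c; rewrite /f.
  under [X in _ -> X + _ + _ <= _]eq_bigr => i _ do rewrite ltn_eqF //.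
  lra.
pose f c := \sum_(i < r) w c i * l i + dot (a c) x - b c.
have [|H0 H1] := (eliminate_variable (fun c => w c r) f).1.
  by exists (l r) => c; have := H c; rewrite big_ord_recr /= /f; lra.
exists l => -[c|[c d]].
  case: eqP => [wc|_]; first by rewrite -subr_le0; exact: H0.
  by rewrite big1 ?dot0l ?addr0 // => i _; rewrite mul0r.
rewrite /pos; case: ifP => [/andP[wc wd]|_]; last first.
  by rewrite big1 ?dot0l ?addr0 // => i _; rewrite mul0r.
rewrite dotDl dotZl -scaleNr dotZl.
under eq_bigr do rewrite mulrBl -!mulrA; rewrite sumrB -!mulr_sumr.
have := H1 c d wc wd; rewrite /f; lra.
Qed.

(** The exit time is the least ratio of slack to growth among the constraints that increase along
    [d]. It is positive because active constraints are constant along [d]. *)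
Lemma ray_exit m (a : 'I_m -> 'rV[R]_n) (b : 'I_m -> R) (x d : 'rV[R]_n) :
    (forall i, dot (a i) x <= b i) ->
    (forall i, dot (a i) x = b i -> dot (a i) d = 0) ->
  (forall i, dot (a i) d <= 0) \/
  exists2 t : R, 0 < t & (forall i, dot (a i) (x + t *: d) <= b i) /\
    exists2 i, dot (a i) x != b i & dot (a i) (x + t *: d) = b i.
Proof.
move=> Px act; have [[i0 di0]|nd] := pselect (exists i, 0 < dot (a i) d); last first.
  by left=> i; rewrite leNgt; apply/negP => di; apply: nd; exists i.
right; pose F i := (b i - dot (a i) x) / dot (a i) d.
case: (@Order.TotalTheory.arg_minP _ _ _ i0 (fun i => 0 < dot (a i) d) F di0).
move=> i di imin.
have ni : dot (a i) x != b i by apply/eqP => /act di'; rewrite di' ltxx in di.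
have F0 : 0 < F i by rewrite divr_gt0 // subr_gt0 lt_neqAle ni Px.
exists (F i) => //; split=> [j|]; last first.
  by exists i => //; rewrite dotDr dotZr divfK ?gt_eqF // addrC subrK.
rewrite dotDr dotZr; have [dj|dj] := ltP 0 (dot (a j) d).
  by have := imin j dj; rewrite {2}/F ler_pdivlMr //; lra.
by have := Px j; nra.
Qed.

(* A point of [P] that is not determined by its active constraints can be moved
   along a line, in both directions until a new constraint becomes active or
   for ever; in the latter case the direction is nonnegative. *)
Lemma polyhedron_vertices P : polyhedron P ->
    (forall x, P x -> forall i, 0 <= x 0 i) ->
  exists2 s : seq 'rV[R]_n, (forall v, v \in s -> P v) &
    forall Q, @convex_set R 'rV[R]_n Q -> orthant_closed Q ->
      (forall v, v \in s -> Q v) -> P `<=` Q.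
Proof.
move=> [m [H [/choice [a /choice [b Hab]] PE]]] P0.
have PP x : P x <-> forall i, dot (a i) x <= b i.
  rewrite PE; split=> Px i; first by have := Px i Logic.I; rewrite (Hab i).2.
  by move=> _; rewrite (Hab i).2; exact: Px.
pose active x := [set i | dot (a i) x == b i]%SET.
pose vertex x := P x /\ forall d, (forall i, i \in active x -> dot (a i) d = 0) ->
  d = 0.
(* Two vertices with the same active set differ by a vector killed by all active constraints, hence
   coincide: there is at most one vertex per set of constraints. *)
have [A _|s sP] := @seq_choice {set 'I_m} 'rV[R]_n (enum {set 'I_m})
  (fun A l => (forall v, v \in l -> vertex v) /\
     forall x, vertex x -> active x = A -> x \in l).
  have [[v [vv vA]]|nv] := pselect (exists v, vertex v /\ active v = A); last first.
    by exists [::]; split=> // x vx xA; case: nv; exists x.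
  exists [:: v]; split=> [x|x vx xA]; first by rewrite inE => /eqP ->.
  rewrite inE -subr_eq0; apply/eqP; apply: vx.2 => i ix.
  have iv : i \in active v by rewrite vA -xA.
  by move: ix iv; rewrite !inE dotDr dotNr => /eqP -> /eqP ->; rewrite subrr.
exists (flatten [seq s A | A <- enum {set 'I_m}]).
  by move=> v /flatten_mapP [A /sP [sv _] /sv []].
move=> Q /convex_setP cQ oQ sQ x.
(* Induction on the number of inactive constraints, which drops at each exit point. *)
have [k] := ubnP #|~: active x|; elim: k x => // k IH x xk Px.
have [vx|nvx] := pselect (vertex x).
  apply: sQ; apply/flatten_mapP; exists (active x); first by rewrite mem_enum.
  by have [_] := sP (active x) (mem_enum _ _); apply.
have [d [dx d0]] : exists d,
    (forall i, dot (a i) x = b i -> dot (a i) d = 0) /\ d <> 0.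
  apply: contrapT => nd; apply: nvx; split=> // d dx; apply: contrapT => d0.
  by apply: nd; exists d; split=> // i ix; apply: dx; rewrite inE ix.
have aP : forall i, dot (a i) x <= b i by exact/PP.
have dxN i : dot (a i) x = b i -> dot (a i) (- d) = 0.
  by move=> /dx di; rewrite dotNr di oppr0.
have exitQ e (t : R) : (forall i, dot (a i) x = b i -> dot (a i) e = 0) ->
    (forall i, dot (a i) (x + t *: e) <= b i) ->
    (exists2 i, dot (a i) x != b i & dot (a i) (x + t *: e) = b i) ->
  Q (x + t *: e).
  move=> ex te [i ni ti]; apply: IH; last exact/PP.
  apply: leq_trans (_ : #|~: active x| <= k)%N => //; apply: proper_card.
  apply/properP; split; last by exists i; rewrite !inE ?ni // ti eqxx.
  apply/fintype.subsetP => j; rewrite !inE; apply: contra => /eqP jx.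
  by rewrite dotDr dotZr ex // mulr0 addr0 jx.
(* If [e 0 i < 0], going along [e] with this step length would bring coordinate [i] of a point of
   [P] to -1. *)
have far e : (forall i, dot (a i) e <= 0) -> forall i, 0 <= e 0 i.
  move=> e0 i; rewrite leNgt; apply/negP => ei.
  have : P (x + ((x 0 i + 1) / - e 0 i) *: e).
    apply/PP => j; rewrite dotDr dotZr; have := aP j; have := e0 j.
    have : 0 <= (x 0 i + 1) / - e 0 i.
      by rewrite divr_ge0 ?oppr_ge0 ?(ltW ei) // addr_ge0 // P0.
    by nra.
  move=> /P0 /(_ i); rewrite !mxE invrN mulrN mulNr mulfVK ?lt_eqF //; lra.
(* If neither ray exits, [d] and [- d] are nonnegative and [d = 0]. If one exits, [x] is its exit
   point plus a nonnegative vector. If both exit, [x] lies between the exit points. *)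
have [/far nd|[t t0 [tP /(exitQ _ _ dx tP) tQ]]] := ray_exit aP dx;
have [/far ndN|[t' t'0 [t'P /(exitQ _ _ dxN t'P) t'Q]]] := ray_exit aP dxN.
- case: d0; apply/rowP => i; have := nd i; have := ndN i; rewrite !mxE.
  by move=> h1 h2; apply/eqP; rewrite eq_le h2 andbT; lra.
- have -> : x = x + t' *: (- d) + t' *: d by rewrite scalerN subrK.
  by apply: oQ => // i; rewrite mxE mulr_ge0 // ltW.
- have -> : x = x + t *: d + t *: (- d) by rewrite scalerN addrK.
  by apply: oQ => // i; rewrite mxE mulr_ge0 // ltW.
- have tt0 : 0 < t + t' by exact: addr_gt0.
  have tn : t + t' != 0 by rewrite gt_eqF.
  have := cQ _ _ (t' / (t + t')) tQ t'Q.
  have -> : (0 <= t' / (t + t') <= 1).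
    by rewrite divr_ge0 ?(ltW t'0) ?(ltW tt0) //= ler_pdivrMr // mul1r lerDr ltW.
  move=> /(_ isT); congr Q; apply/rowP => i; rewrite !mxE; field.
  exact: tn.
Qed.

End Polyhedra.

(** * The limiting body and the Newton-Okounkov body of a graded family *)

Section LimitingBodies.
Variables (R : realType) (n : nat) (E : nat -> set 'X_{1..n}).
Hypothesis Eg : graded_exponents E.

Definition scaled_newton k : set 'rV[R]_n := dilate k%:R^-1 (newton R (E k)).

Definition scaled_exponents : set 'rV[R]_n :=
  \bigcup_(k in [set k | (0 < k)%N]) [set k%:R^-1 *: mnm_vec R m | m in E k].

Let E_up k : upset (E k).
Proof. by case: Eg. Qed.

Let invn0 k : (0 < k)%N -> k%:R^-1 != 0 :> R.
Proof. by rewrite invr_eq0 pnatr_eq0 lt0n. Qed.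

Lemma scaled_newton_convex k : @convex_set R 'rV[R]_n (scaled_newton k).
Proof. by apply: dilate_convex; exact: newton_convex. Qed.

Lemma scaled_newton_orthant k : (0 < k)%N -> orthant_closed (scaled_newton k).
Proof.
move=> k0; apply: orthant_closed_dilate; first by rewrite invr_gt0 ltr0n.
exact: newton_orthant_closed.
Qed.

Lemma mem_scaled_newton k m : E k m -> scaled_newton k (k%:R^-1 *: mnm_vec R m).
Proof. by move=> km; exists (mnm_vec R m) => //; exact: mem_newton. Qed.

Lemma scaled_newton_sub k (A : set 'rV[R]_n) : @convex_set R 'rV[R]_n A ->
  (forall m, E k m -> A (k%:R^-1 *: mnm_vec R m)) -> scaled_newton k `<=` A.
Proof.
move=> /convex_setP cA EA _ [x xE <-].
apply: (newton_sub (A := [set x | A (k%:R^-1 *: x)])) xE => //.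
apply/convex_setP => u v t Au Av t01 /=.
by rewrite scalerDr !scalerA ![k%:R^-1 * _]mulrC -!scalerA; exact: cA.
Qed.

Lemma scaled_newton_mul c k : (0 < c)%N -> (0 < k)%N ->
  scaled_newton c `<=` scaled_newton (k * c).
Proof.
move=> c0 k0; apply: scaled_newton_sub => [|m cm]; first exact: scaled_newton_convex.
have : E (k * c)%N (m *+ k)%MM.
  apply: (sumset_graded Eg); rewrite -[X in sumset _ X]mul1n.
  by apply: sumset_scale => //; exact/sumset1.
move=> /mem_scaled_newton; congr (scaled_newton (k * c)%N).
rewrite mnm_vecM scalerA natrM invfM mulrAC mulVf ?mul1r //.
by rewrite pnatr_eq0 -lt0n.
Qed.

Lemma scaled_newton_ge0 k x : (0 < k)%N -> scaled_newton k x -> forall i, 0 <= x 0 i.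
Proof.
move=> k0 kx i.
apply: (@scaled_newton_sub k [set x | 0 <= x 0 i]) kx => [|m _] /=.
  apply/convex_setP => u v t /= u0 v0 /andP[t0 t1]; rewrite !mxE.
  by rewrite addr_ge0 // mulr_ge0 // subr_ge0.
by rewrite !mxE mulr_ge0 ?invr_ge0.
Qed.

(** With [y = c x], the integer part [b] of [(M + d) y] lies above a sum of [M] exponents of [E c],
    and [b / (M c)] tends to [x] as [M] grows. *)
Lemma scaled_newton_sub_closure c : (0 < c)%N ->
  scaled_newton c `<=` closure scaled_exponents.
Proof.
move=> c0 x xc; apply/closure_rowP => e e0.
have := xc; rewrite /scaled_newton dilateE ?invn0 // invrK =>
  /(newton_floor (@E_up c)) [d H].
set y := c%:R *: x in H; have x0 := scaled_newton_ge0 c0 xc.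
have y0 j : 0 <= y 0 j by rewrite mxE mulr_ge0.
pose s := \sum_j y 0 j.
have s0 : 0 <= s by exact: sumr_ge0.
have ys j : y 0 j <= s by rewrite /s (bigD1 j) //= lerDl sumr_ge0.
(* [M y] and [b] differ by at most [d s + 1] in each coordinate, so this [M] makes the error less
   than [e]. *)
pose M := (Num.trunc ((d%:R * s + 1) / e)).+1.
have Me : d%:R * s + 1 < M%:R * e.
  by rewrite -ltr_pdivrMr //; exact: truncnS_gt.
have M0 : (0 : R) < M%:R by rewrite ltr0n.
have [a + ay] := H (M + d)%N; rewrite addnK => aE.
pose b : 'X_{1..n} := [multinom Num.trunc ((M + d)%:R * y 0 j)%R | j < n].
have bP j : (b j)%:R <= (M + d)%:R * y 0 j < (b j).+1%:R.
  by rewrite mnmE; apply: truncn_itv; exact: mulr_ge0.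
have bE : sumset (E c) M b.
  apply: (upset_le (sumset_up (@E_up c)) aE); apply/mnm_lepP => j.
  rewrite -ltnS -(ltr_nat R); have /andP[_] := bP j; exact: le_lt_trans.
exists ((M * c)%:R^-1 *: mnm_vec R b).
  exists (M * c)%N; first by rewrite /= muln_gt0.
  by exists b => //; exact: sumset_graded bE.
move=> j; have /andP[b1 b2] := bP j; have yj := ys j.
have c1 : (1 : R) <= c%:R by rewrite ler1n.
have cn : c%:R != 0 :> R by rewrite pnatr_eq0 -lt0n.
have -> : x 0 j = c%:R^-1 * y 0 j by rewrite mxE mulrA mulVf ?mul1r.
have -> : ((M * c)%:R^-1 *: mnm_vec R b) 0 j = (b j)%:R / (M%:R * c%:R).
  by rewrite !mxE natrM mulrC.
have -> : c%:R^-1 * y 0 j - (b j)%:R / (M%:R * c%:R) =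
    (M%:R * y 0 j - (b j)%:R) / (M%:R * c%:R).
  by field; rewrite cn gt_eqF.
rewrite normrM [X in _ * X]ger0_norm ?invr_ge0 ?mulr_ge0 // ltr_pdivrMr ?mulr_gt0
  ?ltr0n //.
apply: (@lt_le_trans _ _ (M%:R * e)); last first.
  by rewrite mulrC mulrA ler_peMr // mulr_ge0 // ltW.
have ds : d%:R * y 0 j <= d%:R * s by rewrite ler_wpM2l.
have dy : 0 <= d%:R * y 0 j by rewrite mulr_ge0.
move: b1 b2; rewrite natrD mulrDl -[(b j).+1%:R]natr1 => b1 b2.
rewrite ltr_norml; apply/andP; split; lra.
Qed.

Lemma dominated_scaled_newton c k : (0 < c)%N -> (0 < k)%N ->
  dominated E (E c) c -> scaled_newton k `<=` scaled_newton c.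
Proof.
move=> c0 k0 Ec; apply: scaled_newton_sub => [|m /Ec [q q0 qm]];
  first exact: scaled_newton_convex.
apply/dilateE; first exact: invn0.
have /(sumset_newton (R := R) (@E_up c)) := qm; rewrite muln_gt0 q0 k0 => /(_ isT).
congr newton; rewrite mnm_vecM !natrM !scalerA; congr (_ *: _).
by field; rewrite !pnatr_eq0 -!lt0n q0 c0 k0.
Qed.

Lemma dominated_scaled_newtonE c : (0 < c)%N -> dominated E (E c) c ->
  \bigcup_(k in [set k | (0 < k)%N]) scaled_newton k = scaled_newton c.
Proof.
move=> c0 Ec; apply/seteqP; split=> [x [k k0]|x xc];
  first exact: dominated_scaled_newton.
by exists c.
Qed.

(** Under the hypothesis both sides are the lattice points of [k] times the Newton polyhedron of
    [E c]. *)
Lemma scaled_newton_saturation c : (0 < c)%N ->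
    (forall k, (0 < k)%N -> scaled_newton c = scaled_newton (k * c)) ->
  forall k, (0 < k)%N -> saturation (sumset (E c) k) = saturation (E (k * c)%N).
Proof.
move=> c0 H k k0; apply/seteqP; split.
  apply: saturation_mono; exact: sumset_graded.
move=> m /(saturation_newton (R := R) (@E_up _)) mE.
have kc0 : (0 < k * c)%N by rewrite muln_gt0 k0.
apply: (newton_saturation (R := R)) => //.
have : scaled_newton (k * c) ((k * c)%:R^-1 *: mnm_vec R m) by exists (mnm_vec R m).
rewrite -H // /scaled_newton dilateE ?invn0 // invrK scalerA natrM invfM mulrCA
  mulfV ?mulr1 //.
by rewrite pnatr_eq0 -lt0n.
Qed.

(** For [a] in [E k] the multiple [a *+ c] lies in [E (k * c)], where the hypothesis applies; degree
    0 is trivial. *)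
Lemma saturation_dominated c : (0 < c)%N ->
    (forall k, (0 < k)%N -> saturation (sumset (E c) k) = saturation (E (k * c)%N)) ->
  dominated E (E c) c.
Proof.
move=> c0 H k a ka.
have [->|] := posnP k; first by exists 1%N => //; rewrite muln0.
move=> k0; have aE : E (k * c)%N (a *+ c)%MM.
  rewrite mulnC; apply: (sumset_graded Eg).
  by rewrite -[X in sumset _ X]mul1n; apply: sumset_scale => //; exact/sumset1.
have /(sub_saturation (@E_up _)) := aE; rewrite -H // => -[q q0 qa].
exists q => //; rewrite [(q * c)%N]mulnC mulmM; apply: sumset_mul qa; exact: E_up.
Qed.

(** By finite generation, [x] belongs to it iff [c x] dominates a convex combination of the [g i].
    The weights are then eliminated. *)
Lemma scaled_newton_polyhedron c : (0 < n)%N -> (0 < c)%N ->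
  polyhedron (scaled_newton c).
Proof.
move=> n0 c0; have [r [g [gE Eg']]] := upset_generators (@E_up c).
pose h k : 'X_{1..n} := if insub k is Some i then g i else 0%MM.
have hE (i : 'I_r) : h i = g i by rewrite /h valK.
have cn : c%:R != 0 :> R by rewrite pnatr_eq0 -lt0n.
(* In order: nonnegative weights, total weight at most 1 and at least 1, and one domination
   inequality per coordinate. *)
have := @polyhedron_projection R n n0 r ('I_r + bool + 'I_n)%type
  (fun s k => match s with
     | inl (inl i) => - (k == i)%:R | inl (inr true) => 1 | inl (inr false) => -1
     | inr j => (h k j)%:R end)
  (fun s => match s with inr j => - c%:R *: 'e_j | _ => 0 end)
  (fun s => match s with inl (inr true) => 1 | inl (inr false) => -1 | _ => 0 end).
set Q := [set x | _].
suff -> : scaled_newton c = Q by [].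
have QP x : Q x <-> exists l : 'I_r -> R, [/\ forall i, 0 <= l i, \sum_i l i = 1 &
    forall j, \sum_i l i * (g i j)%:R <= c%:R * x 0 j].
  split=> [[l H]|[l [l0 l1 lx]]].
    exists (fun i => l i); split.
    - move=> i; have := H (inl (inl i)); rewrite dot0l addr0 (bigD1 i) //= eqxx.
      rewrite big1 => [|j /negPf ji]; first by rewrite addr0 mulN1r oppr_le0.
      by rewrite -[_ == _]/(j == i) ji oppr0 mul0r.
    - have := H (inl (inr true)); have := H (inl (inr false));
      rewrite dot0l !addr0 /=.
      under eq_bigr do rewrite mulN1r;
        under [X in _ -> X <= _ -> _]eq_bigr do rewrite mul1r.
      by rewrite sumrN => h1 h2; apply/eqP; rewrite eq_le h2 /=; lra.
    - move=> j; have := H (inr j); rewrite dotZl dot_delta mulNr subr_le0 /=.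
      by under eq_bigr do rewrite hE mulrC.
  exists (fun k => if insub k is Some i then l i else 0) => -[[i|[]]|j].
  - rewrite dot0l addr0 (bigD1 i) //= eqxx valK big1 ?addr0 => [|j /negPf ji].
      by rewrite mulN1r oppr_le0.
    by rewrite -[_ == _]/(j == i) ji oppr0 mul0r.
  - by rewrite dot0l addr0; under eq_bigr do rewrite valK mul1r; rewrite l1.
  - by rewrite dot0l addr0; under eq_bigr do rewrite valK mulN1r; rewrite sumrN l1.
  - rewrite dotZl dot_delta mulNr subr_le0.
    by under eq_bigr do rewrite valK hE mulrC.
apply/seteqP; split.
  apply: scaled_newton_sub => [|m cm].
    apply/convex_setP => u v t /QP [l [l0 l1 lu]] /QP [l' [l'0 l'1 l'v]] /andP[t0 t1].
    have t1' : 0 <= 1 - t by rewrite subr_ge0.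
    apply/QP; exists (fun i => t * l i + (1 - t) * l' i); split.
    - by move=> i; rewrite addr_ge0 // mulr_ge0.
    - by rewrite big_split /= -!mulr_sumr l1 l'1; ring.
    - move=> j; under eq_bigr do rewrite mulrDl -!mulrA.
      rewrite big_split /= -!mulr_sumr !mxE mulrDr ![c%:R * (_ * _)]mulrCA.
      by apply: lerD; apply: ler_wpM2l.
  have [i /mnm_lepP gm] := Eg' m cm; apply/QP.
  exists (fun k => (k == i)%:R); split=> [k||j].
  - by rewrite ler0n.
  - by rewrite (bigD1 i) //= eqxx big1 ?addr0 // => k /negPf ->.
  - rewrite (bigD1 i) //= eqxx mul1r big1 => [|k /negPf -> //]; last by rewrite mul0r.
    by rewrite addr0 !mxE mulrA mulfV // mul1r ler_nat.
move=> x /QP [l [l0 l1 lx]]; apply/dilateE; rewrite ?invn0 // invrK.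
have := convex_sum (v := fun i => mnm_vec R (g i)) (@newton_convex R n (E c)) l0 l1
  (fun i => mem_newton (R := R) (gE i)).
set z := \sum_i _ => zE; rewrite -(subrK z (c%:R *: x)) addrC.
apply: (newton_orthant_closed (@E_up c)) => // j.
rewrite !mxE subr_ge0 summxE (le_trans _ (lx j)) //.
by apply: ler_sum => i _; rewrite !mxE.
Qed.

(** Each of the finitely many vertices lies in some [scaled_newton k]. The product [c] of these [k]
    serves all of them, so [scaled_newton c] contains the whole body, which is closed as a
    polyhedron. *)
Lemma polyhedral_scaled_newton :
  polyhedron (\bigcup_(k in [set k | (0 < k)%N]) scaled_newton k) ->
  exists2 c, (0 < c)%N & closure scaled_exponents = scaled_newton c.
Proof.
set C := \bigcup_(k in _) _ => Cp.
have C0 x : C x -> forall i, 0 <= x 0 i by move=> [k k0]; exact: scaled_newton_ge0.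
have [s sC sP] := polyhedron_vertices Cp C0.
have [f fP] := seq_choice (l := s) (Q := fun v (l : seq nat) =>
  exists k, [/\ l = [:: k], (0 < k)%N & scaled_newton k v])
  (fun v vs => let: ex_intro2 k k0 kv := sC v vs in
    ex_intro _ [:: k] (ex_intro _ k (And3 erefl k0 kv))).
pose c := \prod_(k <- flatten [seq f v | v <- s]) k.
have c0 : (0 < c)%N.
  rewrite /c big_seq; apply: prodn_cond_gt0 => k /flatten_mapP [v /fP [j [-> j0 _]]].
  by rewrite inE => /eqP ->.
have CS : C `<=` scaled_newton c.
  apply: sP; [exact: scaled_newton_convex|exact: scaled_newton_orthant|].
  move=> v vs; have [k [fk k0 kv]] := fP v vs.
  have kc : (k %| c)%N.
    have kin : k \in flatten [seq f v | v <- s].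
      by apply/flatten_mapP; exists v => //; rewrite fk mem_head.
    by rewrite /c (big_rem k) //= dvdn_mulr.
  rewrite -(divnK kc); apply: scaled_newton_mul kv => //.
  by rewrite divn_gt0 // dvdn_leq.
exists c => //; apply/seteqP; split; last exact: scaled_newton_sub_closure.
apply: subset_trans CS; apply: subset_trans (polyhedron_closed Cp).
apply: closure_subset => _ [k k0 [m km <-]]; exists k => //; exact: mem_scaled_newton.
Qed.

Lemma closure_scaled_newton c : (0 < c)%N ->
    closure scaled_exponents = scaled_newton c ->
  forall k, (0 < k)%N -> scaled_newton c = scaled_newton (k * c).
Proof.
move=> c0 cE k k0; apply/seteqP; split; first exact: scaled_newton_mul.
apply: scaled_newton_sub => [|m km]; first exact: scaled_newton_convex.
rewrite -cE; apply: subset_closure; exists (k * c)%N; first by rewrite /= muln_gt0 k0.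
by exists m.
Qed.

End LimitingBodies.

Arguments scaled_newton R {n} E k.
Arguments scaled_exponents R {n} E.

(** * Passage from ideals to exponents, and the equivalences *)

Lemma graded_family_exponents (K : fieldType) (n : nat) (I : nat ->
  set {mpoly K[n]}) :
    graded_family I -> (forall k, (0 < k)%N -> monomial_ideal (I k)) ->
  graded_exponents (fun k => exponents (I k)) /\
  forall k, I k = supported_on (exponents (I k)).
Proof.
move=> [I0 Ii ID] Im; split.
  split=> [|k|p q a b pa qb].
  - by rewrite I0.
  - exact: ideal_exponents_up.
  - by rewrite /exponents /= mpolyXD; apply: ID; exact: mul_ideal_mul.
(* Index 0 is not covered by the monomiality hypothesis, but there the ideal is the whole ring. *)
case=> [|k]; last by have [] := monomial_idealE (Im k.+1 isT).
by rewrite I0 [exponents _](_ : _ = setT) ?supported_setT //; apply/seteqP; split.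
Qed.

Theorem theorem3p4 (K : fieldType) (R : realType) (n : nat)
  (I : nat -> set {mpoly K[n]})
  (n_gt0 : (0 < n)%N)
  (I_graded : graded_family I)
  (I_monomial : forall k : nat, (0 < k)%N -> monomial_ideal (I k)) :
  [<-> polyhedron (limiting_body R I);
       exists2 c : nat, (0 < c)%N &
         newton_okounkov_body R I
           = dilate c%:R^-1 (newton_polyhedron R (I c));
       exists2 c : nat, (0 < c)%N &
         forall k : nat, (0 < k)%N ->
           dilate c%:R^-1 (newton_polyhedron R (I c))
             = dilate (k * c)%:R^-1 (newton_polyhedron R (I (k * c)%N));
       exists2 c : nat, (0 < c)%N &
         forall k : nat, (0 < k)%N ->
           integral_closure (ideal_pow (I c) k)
             = integral_closure (I (k * c)%N);
       noetherian_subring (rees_algebra (fun k => integral_closure (I k)));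
       noetherian_subring (rees_algebra I)].
Proof.
have [Eg IE] := graded_family_exponents I_graded I_monomial.
set E := fun k => exponents (I k) in Eg IE.
have [E0 uE ED] := Eg; have Sg := saturation_graded Eg.
have closE k : integral_closure (I k) = supported_on (saturation (E k)).
  by rewrite IE integral_closure_supported //; exact: uE.
have closP c k : integral_closure (ideal_pow (I c) k) =
    supported_on (saturation (sumset (E c) k)).
  rewrite IE ideal_pow_supported; last exact: uE.
  by rewrite integral_closure_supported //; apply: sumset_up; exact: uE.
have bodyE : limiting_body R I = \bigcup_(k in [set k | (0 < k)%N]) scaled_newton R
  E k by [].
have okE : newton_okounkov_body R I = closure (scaled_exponents R E) by [].
have reesE : rees_algebra I = rees_algebra (fun k => supported_on (E k)).
  by congr rees_algebra; apply/funext => k; exact: IE.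
have reesS : rees_algebra (fun k => integral_closure (I k)) =
    rees_algebra (fun k => supported_on (saturation (E k))).
  by congr rees_algebra; apply/funext => k; exact: closE.
rewrite bodyE okE reesE reesS.
tfae.
- exact: polyhedral_scaled_newton.
- move=> [c c0 cE]; exists c => //; exact: (closure_scaled_newton Eg c0 cE).
- move=> [c c0 cE]; exists c => // k k0; rewrite closP closE.
  by rewrite (scaled_newton_saturation Eg c0 cE).
- move=> [c c0 cE].
  have Ec : dominated E (E c) c.
    apply: saturation_dominated => // k k0; have := cE k k0; rewrite closP closE.
    by move=> /(congr1 (@exponents _ _)); rewrite !exponents_supported.
  (* The dominating set remains [E c], so the same [c] serves the saturated family. *)
  apply: (dominated_noetherian Sg c0 (uE c) _ (dominated_saturation Eg Ec)).
  exact: sub_saturation.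
- move=> /(noetherian_splits Sg) [N NP].
  (* Here the split family is the saturation itself, but the dominating set is taken in [E]; the
     domination is then restricted to [E]. *)
  have /(splits_dominated Eg (fun k _ _ h => h)) Sd := NP.
  have Ed : dominated E (E N`!) N`!.
    by move=> k a ka; apply: Sd; exact: sub_saturation.
  by apply: (dominated_noetherian Eg (fact_gt0 N) (uE _) _ Ed).
- move=> /(noetherian_splits Eg) [N NP].
  have Ed : dominated E (E N`!) N`!.
    by apply: (splits_dominated Eg _ NP) => k _; exact: sub_saturation.
  rewrite (dominated_scaled_newtonE R Eg (fact_gt0 N) Ed).
  exact: scaled_newton_polyhedron (fact_gt0 N).
Qed.
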